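(* Let $(M,J)$ be an almost Hermitian manifold of real dimension $2n$ with fundamental form $\omega$. Let $k\ge 0$ and let $\alpha\in P^k$ be a primitive form of degree $k$, with $d\alpha$ written as $$d\alpha=\alpha_0+L\alpha_1+L^2\alpha_2+\cdots$$ for the unique $\alpha_r\in P^{k+1-2r}$ (the Lefschetz decomposition of $d\alpha$). Then, for all integers $j\ge 0$, $$\begin{aligned} [\Lambda,d]\,L^j\alpha-\star\,\mathbb{I}^{-1}\,d\,\mathbb{I}\,\star\,L^j\alpha ={}&\frac{1}{j+1}\,\mathbb{I}^{-1}\,[d^*,\Lambda]\,\mathbb{I}\,L^{j+1}\alpha\\ &+j\,\Lambda\,[d,L]\,L^{j-1}\alpha+j(j-1)(k-n+j-1)\,[d,L]\,L^{j-2}\alpha\\ &+\sum_{r=2}^{\infty}f_{n,k,j}(r)\,L^{j+r-1}\alpha_r, \end{aligned}$$ where $$f_{n,k,j}(r)=\bigl(r(n-k+r)-j\bigr)+(-1)^r\,\frac{j!\,(n-k-j+r)!}{(j+r-1)!\,(n-k-j)!}.$$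
   Context: An almost Hermitian manifold is a smooth manifold $M$ of real dimension $2n$ with an almost complex structure $J$ (not assumed integrable) and a $J$-compatible Riemannian metric $g$, i.e. $g(J\cdot,J\cdot)=g$. Its fundamental $(1,1)$-form is $\omega(X,Y)=g(JX,Y)$; it is not assumed closed. $\mathcal{A}^k$ denotes the smooth complex-valued $k$-forms, with bigrading $\mathcal{A}^k=\bigoplus_{p+q=k}\mathcal{A}^{p,q}$ induced by $J$, and $d$ is the exterior differential. The Hodge star $\star:\mathcal{A}^{p,q}\to\mathcal{A}^{n-q,n-p}$ is the $\mathbb{C}$-linear operator defined by $\beta\wedge\star\bar\eta=\langle\beta,\eta\rangle\,\mathrm{vol}$, where $\langle\cdot,\cdot\rangle$ is the pointwise Hermitian inner product on forms induced by $g$ and $\mathrm{vol}=\omega^n/n!$. Put $d^*=-\star d\star$. $L$ is the operator $L\eta=\omega\wedge\eta$, and $\Lambda=L^*=\star^{-1}L\star$. Primitive forms are $P^k=\ker\Lambda\cap\mathcal{A}^k$ (with $P^m=0$ for $m<0$). The Lefschetz decomposition is $\mathcal{A}^k=\bigoplus_{r\ge0}L^rP^{k-2r}$; in the decomposition of $d\alpha$ in the statement, the components $L^r\alpha_r$ are determined by it, and $\alpha_r=0$ when $2r>k+1$ or $L^rP^{k+1-2r}=0$. $\mathbb{I}$ is the extension of $J$ to all forms as an algebra map for the wedge product: it acts on $\mathcal{A}^{p,q}$ as multiplication by $i^{p-q}$. Commutators are graded: $[A,B]=AB-(-1)^{|A||B|}BA$, with $|A|$ the total degree of the operator $A$ ($L$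 and $\Lambda$ have even degree, so $[\Lambda,d]=\Lambda d-d\Lambda$, $[d,L]=dL-Ld$, $[d^*,\Lambda]=d^*\Lambda-\Lambda d^*$). Conventions: terms containing $L^{j-1}$ with $j=0$, or $L^{j-2}$ with $j\in\{0,1\}$, have coefficient zero and are read as zero. The ratio $(n-k-j+r)!/(n-k-j)!$ is read as the product $\prod_{s=1}^{r}(n-k-j+s)$, which agrees with the quotient of factorials when $j\le n-k$ and gives it a meaning when $j>n-k$ (in which case $L^j\alpha=0$). *)

(* Defs.v *)
(* R : realType is the field of real numbers, R[i] that of complex numbers. *)
From HB Require Import structures.
From mathcomp Require Import all_boot all_order all_algebra.
From mathcomp Require Import complex.
From mathcomp Require Import all_classical all_reals all_analysis.
Set Implicit Arguments.
Unset Strict Implicit.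
Unset Printing Implicit Defensive.
Import Order.TTheory GRing.Theory Num.Theory.
Import numFieldNormedType.Exports.
Local Open Scope ring_scope.

Section ExteriorAlgebra.
Variables (R : realType) (m : nat).

(* An element of the complexified exterior algebra of the dual of R^m, given by
   its coefficients: eta I is the coefficient of
   dx_I = dx_(i_1) /\ ... /\ dx_(i_k), where I = {i_1 < ... < i_k}.  All
   degrees are allowed at once, so eta need not be homogeneous. *)
Definition exterior : Type := {ffun {set 'I_m} -> R[i]^o}.
HB.instance Definition _ := GRing.Lmodule.on exterior.
HB.instance Definition _ := Choice.on exterior.

Implicit Types (I J K : {set 'I_m}) (a b eta xi : exterior).

Definition basis_form I : exterior := [ffun K : {set 'I_m} => (K == I)%:R].

Definition dx (i : 'I_m) : exterior := basis_form [set i]%SET.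

(* The number of inversions: dx_I /\ dx_J = (-1) ^ inversions I J dx_(I u J)
   when I and J are disjoint. *)
Definition inversions I J : nat := (\sum_(i in I) \sum_(j in J) (j < i))%N.

Definition wedge a b : exterior :=
  [ffun K : {set 'I_m} => \sum_(I : {set 'I_m} | I \subset K)
    (-1) ^+ inversions I (K :\: I) * (a I * b (K :\: I))].

Definition one_form : exterior := basis_form finset.set0.

(* Degrees are integers, so that the only form of negative degree is 0. *)
Definition homogeneous (k : int) eta :=
  forall I, #|I|%:Z != k -> eta I = 0.

Definition hpart (k : nat) eta : exterior :=
  [ffun I : {set 'I_m} => if #|I| == k then eta I else 0].

Definition conj_form eta : exterior := [ffun I : {set 'I_m} => (eta I)^*%C].

(* Tangent vectors are row vectors, and A is the map v |-> v *m A; its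
   transpose sends dx_j to \sum_i A_(i, j) dx_i, and pull A is the extension of
   this transpose to an algebra map for the wedge product (enum I lists I in
   increasing order). *)
Definition pull (A : 'M[R]_m) eta : exterior :=
  \sum_(I : {set 'I_m})
    eta I *: \big[wedge/one_form]_(j <- enum I)
               (\sum_(i < m) (A i j)%:C%C *: dx i).

(* The minor of h with rows I and columns J (0 if they differ in number). *)
Definition minor (h : 'M[R]_m) I J : R :=
  match #|J| =P #|I| with
  | ReflectT e =>
      \det (\matrix_(s < #|J|, t < #|J|)
              h (enum_val (cast_ord e s)) (enum_val t))
  | ReflectF _ => 0
  end.

(* The Hermitian inner product on forms induced by the metric g:
   <dx_I, dx_J> is the Gram determinant of the <dx_i, dx_j>, i in I, j in J,
   where <dx_i, dx_j> are the entries of the inverse of g.  It is linear on the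
   left, antilinear on the right, and forms of different degrees are
   orthogonal. *)
Definition inner (g : 'M[R]_m) a b : R[i] :=
  \sum_(I : {set 'I_m}) \sum_(J : {set 'I_m})
    (minor (invmx g) I J)%:C%C * (a I * (b J)^*%C).

(* star eta is the form xi such that beta /\ xi = <beta, conj eta> vol for all
   beta.  As eta may have components in several degrees, for beta of degree k
   only the component of degree m - k of xi is wedged with beta.  Such an xi
   exists and is unique when vol has degree m: see hodge_starP and
   star_spec_uniq. *)
Definition star_spec (g : 'M[R]_m) (vol eta xi : exterior) :=
  forall (k : nat) (beta : exterior), (k <= m)%N -> homogeneous k beta ->
    wedge beta (hpart (m - k) xi) = inner g beta (conj_form eta) *: vol.

Definition hodge_star (g : 'M[R]_m) (vol eta : exterior) : exterior :=
  xget 0 [set xi | star_spec g vol eta xi]%classic.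

Definition hodge_star_inv (g : 'M[R]_m) (vol eta : exterior) : exterior :=
  xget 0 [set xi | hodge_star g vol xi = eta]%classic.

Lemma card_compl K : (m - #|~: K|)%N = #|K|.
Proof.
have := cardsC K; rewrite [in RHS]card_ord => E.
by rewrite -[X in (X - _)%N]E addnK.
Qed.

Lemma star_spec_uniq g vol eta xi1 xi2 :
  star_spec g vol eta xi1 -> star_spec g vol eta xi2 -> xi1 = xi2.
Proof.
move=> h1 h2; apply/ffunP => K.
have kK : (#|~: K| <= m)%N by rewrite -[X in (_ <= X)%N]card_ord max_card.
have hb : homogeneous #|~: K| (basis_form (~: K)).
  by move=> I; rewrite ffunE; case: (I =P _) => [->|//]; rewrite eqxx.
have := h2 _ _ kK hb; rewrite -(h1 _ _ kK hb) => /ffunP /(_ finset.setT).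
have E xi : wedge (basis_form (~: K)) (hpart (m - #|~: K|) xi) finset.setT
   = (-1) ^+ inversions (~: K) K * xi K.
  rewrite ffunE (bigD1 (~: K)) ?finset.subsetT //= big1 ?addr0; last first.
    by move=> I /andP[_ /negPf nI]; rewrite ffunE nI mul0r mulr0.
  rewrite !ffunE eqxx finset.setTD finset.setCK mul1r.
  by rewrite card_compl eqxx.
by rewrite !E => /(mulfI _) -> //; rewrite signr_eq0.
Qed.

Lemma star_spec_ex g vol eta :
  homogeneous m vol -> exists xi, star_spec g vol eta xi.
Proof.
move=> hvol.
pose xi : exterior := [ffun K : {set 'I_m} => (-1) ^+ inversions (~: K) K *
  (inner g (basis_form (~: K)) (conj_form eta) * vol finset.setT)].
exists xi => k beta km hb; apply/ffunP => L.
rewrite !ffunE; case: (eqVneq L finset.setT) => [->|LT]; last first.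
  rewrite [vol L]hvol ?scaler0; last first.
    apply: contraNneq LT => -[] cL; rewrite -[_ == _]/(_ == _).
    by rewrite finset.eqEcard finset.subsetT cardsT card_ord cL /=.
  rewrite big1 // => I IL; rewrite ffunE.
  case: (eqVneq #|I| k) => [cI|cI]; last by rewrite hb ?mul0r ?mulr0.
  case: eqP => [cD|]; last by rewrite !mulr0.
  case/negP: LT; rewrite finset.eqEcard finset.subsetT cardsT card_ord.
  rewrite -(finset.cardsID I L) (finset.setIidPr IL) cI cD.
  by rewrite /= (subnKC km) leqnn.
transitivity (\sum_(I : {set 'I_m})
   beta I * (inner g (basis_form I) (conj_form eta) * vol finset.setT)).
  apply: eq_big => [I|I _]; first by rewrite finset.subsetT.
  case: (eqVneq #|I| k) => [cI|cI]; last by rewrite hb ?mul0r ?mulr0.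
  rewrite !ffunE finset.setTD finset.setCK.
  have := card_compl (~: I); rewrite finset.setCK cI => ->; rewrite eqxx.
  by rewrite mulrCA [X in _ * X]mulrA -expr2 sqrr_sign mul1r.
under eq_bigr do rewrite mulrA.
rewrite -mulr_suml; congr (_ * _).
rewrite /inner; apply: eq_bigr => I _.
rewrite (bigD1 I) //= [X in _ + X]big1 ?addr0; last first.
  move=> J JI; rewrite big1 // => K _.
  by rewrite [basis_form I J]ffunE (negPf JI) mul0r mulr0.
rewrite mulr_sumr; apply: eq_bigr => J _.
by rewrite [basis_form I I]ffunE eqxx mul1r mulrCA.
Qed.

Lemma hodge_starP g vol eta :
  homogeneous m vol -> star_spec g vol eta (hodge_star g vol eta).
Proof. by move=> hvol; apply: (xgetPex 0 (star_spec_ex g eta hvol)). Qed.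

End ExteriorAlgebra.

Section Smooth.
Variables (R : realType) (m : nat).

Fixpoint Ck_on (k : nat) (U : set 'rV[R]_m) (f : 'rV[R]_m -> R) : Prop :=
  (forall x, U x -> {for x, continuous f}) /\
  (if k is k'.+1 then
     forall i : 'I_m, (forall x, U x -> derivable f x 'e_i) /\
                      Ck_on k' U (fun x => 'D_('e_i) f x)
   else True).

Definition smooth_on (U : set 'rV[R]_m) (f : 'rV[R]_m -> R) :=
  forall k, Ck_on k U f.

Definition partialC (i : 'I_m) (f : 'rV[R]_m -> R[i]) (x : 'rV[R]_m) : R[i] :=
  ('D_('e_i) (fun y => complex.Re (f y)) x
    +i* 'D_('e_i) (fun y => complex.Im (f y)) x)%C.

End Smooth.

(* Smooth manifolds without boundary of dimension m, given by an atlas (not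
   necessarily maximal). chart a is only meaningful on dom a, and chart_inv a
   on the image of dom a. *)
Record smoothManifold (R : realType) (m : nat) := SmoothManifold {
  points :> topologicalType ;
  hausdorff_points : hausdorff_space points ;
  second_countable_points : @second_countable points ;
  charts : Type ;
  dom : charts -> set points ;
  chart : charts -> points -> 'rV[R]_m ;
  chart_inv : charts -> 'rV[R]_m -> points ;
  charts_cover : forall p, exists a, dom a p ;
  dom_open : forall a, open (dom a) ;
  chart_image_open : forall a, open (chart a @` dom a)%classic ;
  chartK : forall a p, dom a p -> chart_inv a (chart a p) = p ;
  chart_continuous : forall a p, dom a p -> {for p, continuous (chart a)} ;
  chart_inv_continuous : forall a p, dom a p ->
    {for chart a p, continuous (chart_inv a)} ;
  transition_smooth : forall (a b : charts) (j : 'I_m),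
    smooth_on (chart a @` (dom a `&` dom b))%classic
              (fun x => chart b (chart_inv a x) 0 j)
}.

Arguments dom {R m s}.
Arguments chart {R m s}.
Arguments chart_inv {R m s}.

Section Manifold.
Variables (R : realType) (m : nat) (M : smoothManifold R m).
Local Notation C := (charts M).

Definition smooth_fun (a : C) (f : M -> R) :=
  smooth_on (chart a @` dom a)%classic (fun x => f (chart_inv a x)).

(* The Jacobian matrix at p of the change of charts from a to b: a tangent
   vector v at p, written in a, becomes v *m jac a b p in b. *)
Definition jac (a b : C) (p : M) : 'M[R]_m :=
  \matrix_(i, j)
    'D_('e_i) (fun x => chart b (chart_inv a x) 0 j) (chart a p).

(* A family of local expressions: w a p is the value at p of the form, written
   with the coordinates of the chart a; it is only meaningful if dom a p.
   Such a family is a smooth differential form on M when is_form w holds. *)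
Definition diffForm : Type := C -> M -> exterior R m.
HB.instance Definition _ := GRing.Lmodule.on diffForm.

Definition is_form (w : diffForm) :=
  (forall a (I : {set 'I_m}),
     smooth_fun a (fun p => complex.Re (w a p I)) /\
     smooth_fun a (fun p => complex.Im (w a p I))) /\
  (forall a b p, dom a p -> dom b p -> w a p = pull (jac a b p) (w b p)).

Definition form_eq (w1 w2 : diffForm) := forall a p, dom a p -> w1 a p = w2 a p.

(* Membership in \mathcal{A}^k. *)
Definition is_kform (k : int) (w : diffForm) :=
  is_form w /\ (forall a p, dom a p -> homogeneous k (w a p)).

Definition ext_d (w : diffForm) : diffForm := fun a p =>
  \sum_(i < m) wedge (dx R i)
    [ffun I : {set 'I_m} => partialC i (fun x => w a (chart_inv a x) I) (chart a p)].

End Manifold.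

Notation "w1 =_form w2" := (form_eq w1 w2) (at level 70, no associativity).

(* J a p and g a p are the matrices at p of the almost complex structure and of
   the metric in the chart a: J X is X *m J a p and g(X, Y) is
   X *m g a p *m Y^T. *)
Record almostHermitian (R : realType) (n : nat)
    (M : smoothManifold R n.*2) := AlmostHermitian {
  cplx : charts M -> M -> 'M[R]_(n.*2) ;
  metric : charts M -> M -> 'M[R]_(n.*2) ;
  cplx_smooth : forall a i j, smooth_fun a (fun p => cplx a p i j) ;
  metric_smooth : forall a i j, smooth_fun a (fun p => metric a p i j) ;
  cplx_chart : forall a b p, dom a p -> dom b p ->
    cplx a p *m jac a b p = jac a b p *m cplx b p ;
  metric_chart : forall a b p, dom a p -> dom b p ->
    metric a p = jac a b p *m metric b p *m (jac a b p)^T ;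
  cplx_sqr : forall a p, dom a p -> cplx a p *m cplx a p = (- 1)%:M ;
  metric_sym : forall a p, dom a p -> (metric a p)^T = metric a p ;
  metric_pos : forall a p (v : 'rV[R]_(n.*2)), dom a p -> v != 0 ->
    0 < (v *m metric a p *m v^T) 0 0 ;
  metric_cplx : forall a p, dom a p ->
    cplx a p *m metric a p *m (cplx a p)^T = metric a p
}.

Section AlmostHermitianOperators.
Variables (R : realType) (n : nat) (M : smoothManifold R n.*2).
Variable H : almostHermitian M.
Implicit Types w : diffForm M.

(* omega(X, Y) = g(J X, Y), so J *m g is the matrix of omega and its entry
   (i, j), i < j, is the coefficient of dx_i /\ dx_j. *)
Definition omega : diffForm M := fun a p =>
  \sum_(i < n.*2) \sum_(j < n.*2 | (i < j)%N)
    ((cplx H a p *m metric H a p) i j)%:C%C *: wedge (dx R i) (dx R j).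

Definition vol : diffForm M := fun a p =>
  (n`!%:R)^-1 *: iter n (wedge (omega a p)) (one_form R n.*2).

Definition star w : diffForm M := fun a p =>
  hodge_star (metric H a p) (vol a p) (w a p).

Definition star_inv w : diffForm M := fun a p =>
  hodge_star_inv (metric H a p) (vol a p) (w a p).

Definition dstar w : diffForm M := - star (ext_d (star w)).

Definition lef w : diffForm M := fun a p => wedge (omega a p) (w a p).

Definition lam w : diffForm M := star_inv (lef (star w)).

(* On 1-forms, (J eta)(X) = eta(J X), so that J is i on (1,0)-forms and the
   algebra map bbI is i ^ (p - q) on (p,q)-forms.  The inverse of the algebra
   map is the extension of the inverse of J. *)
Definition bbI w : diffForm M := fun a p => pull (cplx H a p) (w a p).

Definition bbI_inv w : diffForm M := fun a p => pull (invmx (cplx H a p)) (w a p).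

(* The graded commutator of two operators, one of which has even degree. *)
Definition comm_op (A B : diffForm M -> diffForm M) w : diffForm M := A (B w) - B (A w).

(* Membership in P^k; P^k = 0 for k < 0 because k-forms are then 0. *)
Definition is_primitive (k : int) w := is_kform k w /\ lam w =_form 0.

(* eta = \sum_(r >= 0) L^r al_r with al_r in P^(k - 2 r), where eta has degree
   k.  The sum is cut at r = k since al_r = 0 when 2 r > k.  The second
   condition normalizes al_r to 0 when L^r P^(k - 2 r) = 0. *)
Definition lefschetz_decomposition (k : nat) (eta : diffForm M)
    (al : nat -> diffForm M) :=
  [/\ forall r, is_primitive (k%:Z - (2 * r)%:Z) (al r),
      forall r, (forall b, is_primitive (k%:Z - (2 * r)%:Z) b ->
                           iter r lef b =_form 0) -> al r =_form 0
    & eta =_form \sum_(0 <= r < k.+1) iter r lef (al r)].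

End AlmostHermitianOperators.

(* (n - k - j + r)! / (n - k - j)! is read as the product of the n - k - j + s,
   1 <= s <= r. *)
Definition f_coef (F : fieldType) (n k j r : nat) : F :=
  (r%:R * (n%:R - k%:R + r%:R) - j%:R)
  + (-1) ^+ r * (j`!%:R * \prod_(1 <= s < r.+1) (n%:R - k%:R - j%:R + s%:R))
      / ((j + r - 1)`!)%:R.

(* Main.v *)
(* Everything except d is pointwise.  On the exterior algebra of one tangent
   space put e_i = dx_i /\ . and let iota_i be the contraction with the i-th
   coordinate vector; they satisfy the Clifford relations.  The forms of degree
   k are spanned by e_i applied to forms of degree k - 1, so linear operators
   are compared through their commutation with the e_i:
   - the Gram determinants in the definition of the star are the coefficients
     of pull (g^-1), whence star e_j = (sum_i g^ij iota_i) star (-1)^deg;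
   - hence star L = Lambda star with Lambda quadratic in the iota_i, and
     [Lambda, L] = n - k on k-forms, star^2 = (-1)^k and star I = I star follow;
   - if x is primitive of degree k then so are the iota_i x, of degree k - 1,
     and k x = sum_i e_i (iota_i x), so that induction on k gives
     star x = (-1)^(k(k+1)/2) / (n-k)! L^(n-k) I x; as star L = Lambda star,
     star L^j x = (-1)^(k(k+1)/2) j! / (n-k-j)! L^(n-k-j) I x follows.
   The only input from calculus is d (L w) = L (d w) + d omega /\ w.  Expanding
   both sides of the theorem with these rules, the terms containing d omega
   cancel, and the coefficients of L^(j+r-1) alpha_r agree for r >= 2 and
   vanish for r = 0, 1. *)

Require Import Defs.
From HB Require Import structures.
From mathcomp Require Import all_boot all_order all_algebra.
From mathcomp Require Import complex ring zify.
From mathcomp Require Import all_classical all_reals all_analysis.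
Set Implicit Arguments.
Unset Strict Implicit.
Unset Printing Implicit Defensive.
Import Order.TTheory GRing.Theory Num.Theory.
Import numFieldNormedType.Exports.
Local Open Scope ring_scope.

(** * Creation and annihilation operators *)

Section ExteriorCalculus.
Variables (R : realType) (m : nat).
Local Notation ext := (exterior R m).
Implicit Types (i j l : 'I_m) (I J K : {set 'I_m}) (x y : ext).

(* The sign by which dx_i moves to its place in dx_(i |: K). *)
Definition sgn_ins i K : R[i] := (-1) ^+ inversions [set i]%SET K.

Lemma inversions1E i K : inversions [set i]%SET K = (\sum_(j in K) (j < i))%N.
Proof. by rewrite /inversions big_set1. Qed.

Lemma sgn_insK i K : sgn_ins i K * sgn_ins i K = 1.
Proof. by rewrite -expr2 sqrr_sign. Qed.

Lemma sgn_ins_setU1 i j K : j \notin K -> sgn_ins i (j |: K) = (-1) ^+ (j < i)%N * sgn_ins i K.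
Proof. by move=> jK; rewrite /sgn_ins !inversions1E big_setU1 //= exprD. Qed.

Lemma sgn_ins_setD1 i j K : j \in K -> sgn_ins i (K :\ j) = (-1) ^+ (j < i)%N * sgn_ins i K.
Proof.
move=> jK; rewrite /sgn_ins !inversions1E [X in _ * _ ^+ X](big_setD1 j) //= exprD.
by rewrite mulrA -expr2 sqrr_sign mul1r.
Qed.

Lemma sgn_ins_setD1_id i K : sgn_ins i (K :\ i) = sgn_ins i K.
Proof.
case iK: (i \in K); first by rewrite sgn_ins_setD1 // ltnn mul1r.
by congr sgn_ins; apply/setP => j; rewrite finset.in_setD1; case: eqP => // ->.
Qed.

Lemma sgn_ins_setU1_id i K : sgn_ins i (i |: K) = sgn_ins i K.
Proof.
case iK: (i \in K); last by rewrite sgn_ins_setU1 ?iK // ltnn mul1r.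
by congr sgn_ins; apply/setP => j; rewrite finset.in_setU1; case: eqP => // ->.
Qed.

(** Wedge with dx_i and, below, contraction with the i-th coordinate vector. Both act on
    coefficients, so that the Clifford relations reduce to a comparison of signs. *)
Definition crea i x : ext :=
  [ffun K : {set 'I_m} => if i \in K then sgn_ins i K * x (K :\ i) else 0].
Definition anni i x : ext :=
  [ffun K : {set 'I_m} => if i \in K then 0 else sgn_ins i K * x (i |: K)].

Lemma extD x y K : (x + y) K = x K + y K. Proof. by rewrite ffunE. Qed.
Lemma extN x K : (- x) K = - x K. Proof. by rewrite ffunE. Qed.
Lemma extZ (c : R[i]) x K : (c *: x) K = c * x K. Proof. by rewrite ffunE. Qed.
Lemma ext0 K : (0 : ext) K = 0. Proof. by rewrite ffunE. Qed.
Lemma ext_sum (T : Type) (r : seq T) (P : pred T) (F : T -> ext) K :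
  (\sum_(t <- r | P t) F t) K = \sum_(t <- r | P t) F t K.
Proof. by elim/big_rec2: _ => [|t u v _ <-]; rewrite ffunE. Qed.

Lemma crea_is_linear i : linear (crea i).
Proof.
move=> c x y; apply/ffunP => K; rewrite extD extZ !ffunE.
by case: ifP; rewrite ?mulr0 ?addr0 // mulrDr mulrCA.
Qed.
HB.instance Definition _ i :=
  GRing.isLinear.Build R[i] ext ext *:%R (crea i) (crea_is_linear i).

Lemma anni_is_linear i : linear (anni i).
Proof.
move=> c x y; apply/ffunP => K; rewrite extD extZ !ffunE.
by case: ifP; rewrite ?mulr0 ?addr0 // mulrDr mulrCA.
Qed.
HB.instance Definition _ i :=
  GRing.isLinear.Build R[i] ext ext *:%R (anni i) (anni_is_linear i).

(** The source of every minus sign in the anticommutation relations: exactly one of the two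
    comparisons holds. *)
Lemma sign_anti i j : i != j ->
  (-1) ^+ (i < j)%N = - (-1) ^+ (j < i)%N :> R[i].
Proof. by move=> ij; case: ltngtP ij => [||/ord_inj->]; rewrite ?eqxx ?opprK. Qed.

Lemma crea2 i x : crea i (crea i x) = 0.
Proof.
by apply/ffunP => K; rewrite !ffunE finset.setD11 mulr0 if_same.
Qed.

Lemma creaC i j x : crea i (crea j x) = - crea j (crea i x).
Proof.
case: (eqVneq i j) => [->|ij]; first by rewrite !crea2 oppr0.
apply/ffunP => K; have ji := ij; rewrite eq_sym in ji.
rewrite extN !ffunE !finset.in_setD1 ij ji /=.
case iK: (i \in K); last by rewrite mulr0 if_same oppr0.
case jK: (j \in K); last by rewrite mulr0 oppr0.
rewrite sgn_ins_setD1 // sgn_ins_setD1 // !finset.setDDl [[set j]%SET :|: _]finset.setUC.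
by rewrite (sign_anti ij); ring.
Qed.

Lemma anni2 i x : anni i (anni i x) = 0.
Proof.
by apply/ffunP => K; rewrite !ffunE finset.setU11 mulr0 if_same.
Qed.

Lemma anniC i j x : anni i (anni j x) = - anni j (anni i x).
Proof.
case: (eqVneq i j) => [->|ij]; first by rewrite !anni2 oppr0.
apply/ffunP => K; have ji := ij; rewrite eq_sym in ji.
rewrite extN !ffunE !finset.in_setU1 (negPf ij) (negPf ji) /=.
case iK: (i \in K); first by rewrite mulr0 if_same oppr0.
case jK: (j \in K); first by rewrite mulr0 oppr0.
rewrite sgn_ins_setU1 ?iK // sgn_ins_setU1 ?jK // !finset.setUA.
rewrite [[set j]%SET :|: _]finset.setUC.
by rewrite (sign_anti ij); ring.
Qed.

Lemma anni_crea i j x :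
  anni i (crea j x) = (i == j)%:R *: x - crea j (anni i x).
Proof.
apply/ffunP => K; rewrite extD extN extZ !ffunE.
case: (eqVneq i j) => [<-|ij].
  rewrite finset.setU11 finset.setD11 mul1r.
  case: ifPn => iK.
    by rewrite finset.setD1K // sgn_ins_setD1_id mulrA sgn_insK mul1r subrr.
  rewrite subr0 sgn_ins_setU1_id mulrA sgn_insK mul1r finset.setU1K //.
have ji := ij; rewrite eq_sym in ji.
rewrite mul0r add0r finset.in_setU1 finset.in_setD1 ij (negPf ji) /=.
case iK: (i \in K); first by rewrite mulr0 if_same oppr0.
case jK: (j \in K); last by rewrite mulr0 oppr0.
rewrite sgn_ins_setU1 ?iK // sgn_ins_setD1 //.
have -> : (i |: K) :\ j = i |: K :\ j.
  by rewrite finset.setDUl; congr (_ :|: _); apply/finset.setDidPl;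
     rewrite disjoints1 finset.in_set1.
by rewrite (sign_anti ij); ring.
Qed.

Lemma crea_basis i K :
  crea i (basis_form R K) = if i \in K then 0 else sgn_ins i K *: basis_form R (i |: K).
Proof.
apply/ffunP => J; rewrite !ffunE; case: ifPn => iJ; last first.
  case: ifPn => iK; rewrite ?ext0 // extZ ffunE.
  by case: eqP iJ => [->|]; rewrite ?finset.setU11 ?mulr0.
case: ifPn => iK; rewrite ?ext0 ?extZ ?ffunE.
  by case: eqP iK => [<-|]; rewrite ?finset.setD11 ?mulr0.
have -> : (J :\ i == K) = (J == i |: K).
  by apply/eqP/eqP => [<-|->]; rewrite ?finset.setD1K ?finset.setU1K.
by case: eqP => [->|]; rewrite ?mulr0 // sgn_ins_setU1_id.
Qed.

Lemma anni_one i : anni i (one_form R m) = 0.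
Proof.
apply/ffunP => K; rewrite !ffunE; case: ifP => // iK.
by case: eqP => [/setP/(_ i)|]; rewrite ?mulr0 // finset.setU11 finset.in_set0.
Qed.

Lemma ext_basis x : x = \sum_K x K *: basis_form R K.
Proof.
apply/ffunP => K; rewrite ext_sum (bigD1 K) //= big1 ?addr0.
  by rewrite extZ ffunE eqxx mulr1.
by move=> J /negPf JK; rewrite extZ ffunE eq_sym JK mulr0.
Qed.

(** The form 1 and the operators [crea i] generate all basis forms: any element of K can be peeled
    off, and closure under scalars absorbs the sign. *)
Lemma basis_ind (P : ext -> Prop) :
  P (one_form R m) -> (forall (c : R[i]) x, P x -> P (c *: x)) ->
  (forall i x, P x -> P (crea i x)) -> forall K, P (basis_form R K).
Proof.
move=> P1 PZ Pc K; have [k] := ubnP #|K|.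
elim: k K => // k IH K; rewrite ltnS => cK.
have [->//|/finset.set0Pn[i iK]] := eqVneq K finset.set0.
have -> : basis_form R K = sgn_ins i K *: crea i (basis_form R (K :\ i)).
  rewrite crea_basis finset.setD11 finset.setD1K // sgn_ins_setD1_id scalerA.
  by rewrite sgn_insK scale1r.
apply: PZ; apply: Pc; apply: IH; apply: leq_trans cK.
by rewrite [X in (_ < X)%N](cardsD1 i) iK.
Qed.

Lemma ext_ind (P : ext -> Prop) :
  P (one_form R m) -> (forall (c : R[i]) x, P x -> P (c *: x)) ->
  (forall x y, P x -> P y -> P (x + y)) ->
  (forall i x, P x -> P (crea i x)) -> forall x, P x.
Proof.
move=> P1 PZ PD Pc x; rewrite [x]ext_basis.
have P0 : P 0 by rewrite -(scale0r (one_form R m)); apply: PZ.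
by apply: big_ind => // K _; exact/(PZ)/(basis_ind P1 PZ Pc).
Qed.

(** The tool by which operators are compared below: only their behaviour on 1 and against each
    [crea i] has to be known. *)
Lemma linear_ext_crea (f g : {linear ext -> ext}) :
  f (one_form R m) = g (one_form R m) ->
  (forall i x, f x = g x -> f (crea i x) = g (crea i x)) -> f =1 g.
Proof.
move=> fg1 fgc; apply: ext_ind => // [c x fx|x y fx fy].
  by rewrite !linearZ fx.
by rewrite !linearD fx fy.
Qed.

Lemma wedge_is_linear (a : ext) : linear (wedge a).
Proof.
move=> c x y; apply/ffunP => K; rewrite extD extZ !ffunE mulr_sumr -big_split.
apply: eq_bigr => I _; rewrite extD extZ /=.
by rewrite mulrDr mulrDr; congr (_ + _); ring.
Qed.
HB.instance Definition _ (a : ext) :=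
  GRing.isLinear.Build R[i] ext ext *:%R (wedge a) (wedge_is_linear a).

Lemma wedgeZl (c : R[i]) (a x : ext) : wedge (c *: a) x = c *: wedge a x.
Proof.
apply/ffunP => K; rewrite extZ !ffunE mulr_sumr.
by apply: eq_bigr => I _; rewrite extZ -mulrA mulrCA.
Qed.

Lemma wedgeDl (a b x : ext) : wedge (a + b) x = wedge a x + wedge b x.
Proof.
apply/ffunP => K; rewrite extD !ffunE -big_split.
by apply: eq_bigr => I _; rewrite extD /= mulrDl mulrDr.
Qed.

Lemma wedge_suml (T : Type) (r : seq T) (P : pred T) (F : T -> ext) x :
  wedge (\sum_(t <- r | P t) F t) x = \sum_(t <- r | P t) wedge (F t) x.
Proof.
elim/big_rec2: _ => [|t u v _ <-]; last by rewrite wedgeDl.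
by rewrite -(scale0r (0 : ext)) wedgeZl !scale0r.
Qed.

Lemma wedge_basis I x K : wedge (basis_form R I) x K =
  if I \subset K then (-1) ^+ inversions I (K :\: I) * x (K :\: I) else 0.
Proof.
rewrite ffunE; case: ifPn => IK.
  rewrite (bigD1 I) //= big1 ?addr0; first by rewrite ffunE eqxx mul1r.
  by move=> J /andP[_ /negPf JI]; rewrite ffunE JI mul0r mulr0.
rewrite big1 // => J JK; rewrite ffunE; case: eqP => [JI|]; last by rewrite mul0r mulr0.
by rewrite -JI JK in IK.
Qed.

Lemma wedge_dx i x : wedge (dx R i) x = crea i x.
Proof.
apply/ffunP => K; rewrite wedge_basis ffunE finset.sub1set; case: ifP => // iK.
by rewrite -/(sgn_ins _ _) sgn_ins_setD1_id.
Qed.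

Lemma inversionsUl I J K : [disjoint I & J] ->
  inversions (I :|: J) K = (inversions I K + inversions J K)%N.
Proof.
move=> IJ; rewrite /inversions -bigU //; apply: eq_bigl => l.
by rewrite finset.in_setU.
Qed.

(** The instance of associativity needed to rewrite the wedge with omega through the [crea i]. *)
Lemma wedge_dx2 i j x : (i < j)%N ->
  wedge (wedge (dx R i) (dx R j)) x = crea i (crea j x).
Proof.
move=> ij; have nij : (i == j) = false by apply/negP => /eqP e; rewrite e ltnn in ij.
have s1 : sgn_ins i [set j]%SET = 1.
  by rewrite -[[set j]%SET]finset.setU0 sgn_ins_setU1 ?finset.in_set0 // ltnNge (ltnW ij)
     /sgn_ins inversions1E big_set0 mulr1.
rewrite wedge_dx crea_basis finset.in_set1 nij s1 scale1r.
apply/ffunP => K; rewrite wedge_basis !ffunE finset.in_setD1 eq_sym nij /=.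
rewrite finset.subUset !finset.sub1set.
case iK: (i \in K) => //=; case: ifP => jK; last by rewrite mulr0.
rewrite mulrA inversionsUl ?disjoints1 ?finset.in_set1 ?nij // exprD -!/(sgn_ins _ _).
rewrite -finset.setDDl; congr (_ * _ * _); rewrite ?sgn_ins_setD1_id //.
rewrite sgn_ins_setD1 ?finset.in_setD1 ?jK 1?eq_sym ?nij // ltnNge (ltnW ij).
by rewrite mul1r sgn_ins_setD1_id.
Qed.

Implicit Types (f : 'I_m -> {linear ext -> ext}) (A B : 'M[R]_m).

(** For [crea], the wedge with the pull-back of dx_j by A; for [anni], the contraction with column j
    of A. *)
Definition mixM f A j x : ext := \sum_i (A i j)%:C%C *: f i x.

Lemma mixM_is_linear f A j : linear (mixM f A j).
Proof.
move=> c x y; rewrite /mixM scaler_sumr -big_split; apply: eq_bigr => i _ /=.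
by rewrite linearP scalerDr !scalerA mulrC.
Qed.
HB.instance Definition _ f A j :=
  GRing.isLinear.Build R[i] ext ext *:%R (mixM f A j) (mixM_is_linear f A j).

Lemma mixM_mul f A B j x :
  mixM f (A *m B) j x = \sum_l (B l j)%:C%C *: mixM f A l x.
Proof.
rewrite /mixM; under [RHS]eq_bigr do rewrite scaler_sumr.
rewrite exchange_big; apply: eq_bigr => k _ /=.
rewrite mxE rmorph_sum scaler_suml; apply: eq_bigr => l _ /=.
by rewrite scalerA rmorphM mulrC.
Qed.

Lemma mixM_scalar f (c : R) j x : mixM f c%:M j x = c%:C%C *: f j x.
Proof.
rewrite /mixM (bigD1 j) //= mxE eqxx mulr1n big1 ?addr0 // => l /negPf li.
by rewrite mxE li scale0r.
Qed.

Lemma mixMN f A j x : mixM f (- A) j x = - mixM f A j x.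
Proof. by rewrite -sumrN; apply: eq_bigr => i _; rewrite mxE rmorphN scaleNr. Qed.

End ExteriorCalculus.

(** * Pull-backs and Gram determinants *)

Section PullBack.
Variables (R : realType) (m : nat).
Local Notation ext := (exterior R m).
Implicit Types (i j l : 'I_m) (I J K : {set 'I_m}) (x y : ext) (A B : 'M[R]_m).
Local Notation crea := (@crea R m).
Local Notation anni := (@anni R m).
Local Notation creaM := (mixM crea).
Local Notation one := (one_form R m).

Lemma enum_setD1 i I : enum (I :\ i) = rem i (enum I).
Proof.
rewrite (rem_filter _ (enum_uniq _)) /enum_mem /enum_mem -filter_predI.
by apply: eq_filter => l /=; rewrite finset.in_setD1.
Qed.

Lemma sorted_enum_ord I : sorted (fun i j : 'I_m => (i < j)%N) (enum I).
Proof.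
rewrite /enum_mem; apply: sorted_filter; first by move=> i j l; apply: ltn_trans.
by rewrite -enumT -(@sorted_map _ _ val ltn) val_enum_ord iota_ltn_sorted.
Qed.

(** Since [enum I] is increasing, the elements of I below i are exactly those listed before it. *)
Lemma sgn_ins_index i I : i \in I -> sgn_ins R i I = (-1) ^+ index i (enum I).
Proof.
rewrite /sgn_ins inversions1E => iI; congr (_ ^+ _).
have -> : (\sum_(j in I) (j < i) = \sum_(j <- enum I) (j < i))%N.
  by rewrite big_enum.
have : i \in enum I by rewrite mem_enum.
elim: (enum I) (sorted_enum_ord I) => // a s IH /= sas.
have asl : all (fun j : 'I_m => (a < j)%N) s.
  by apply: (order_path_min _ sas) => u v w; apply: ltn_trans.
rewrite big_cons in_cons; case: eqP => [-> _|/nesym/eqP ai /= iS].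
  rewrite eqxx ltnn big_seq big1 // => j /(allP asl).
  by case: ltngtP.
by rewrite (negPf ai) (allP asl _ iS) IH // (path_sorted sas).
Qed.

Lemma crea_creaM A i j x : crea i (creaM A j x) = - creaM A j (crea i x).
Proof.
rewrite /mixM linear_sum -sumrN /=; apply: eq_bigr => l _.
by rewrite linearZ /= creaC scalerN.
Qed.

Lemma creaMC A i j x : creaM A i (creaM A j x) = - creaM A j (creaM A i x).
Proof.
rewrite [LHS]/mixM [creaM A i x]/mixM (linear_sum (creaM A j)) -sumrN /=.
apply: eq_bigr => l _.
by rewrite [in RHS]linearZ /= crea_creaM scalerN.
Qed.

Lemma creaM2 A i x : creaM A i (creaM A i x) = 0.
Proof.
have := creaMC A i i x; move/eqP; rewrite -addr_eq0 -mulr2n -scaler_nat.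
by rewrite scaler_eq0 pnatr_eq0 /= => /eqP.
Qed.

(** The pull-back of a product of the dx_j along an arbitrary list, possibly unsorted or with
    repetitions. *)
Definition words A (s : seq 'I_m) : ext := foldr (creaM A) one s.

Lemma words_insert A i s1 s2 :
  words A (s1 ++ i :: s2) = (-1) ^+ size s1 *: creaM A i (words A (s1 ++ s2)).
Proof.
elim: s1 => [|a s IH] /=; first by rewrite scale1r.
by rewrite IH linearZ /= creaMC exprS -scalerA scaleN1r scalerN.
Qed.

Lemma words_mem A i s : i \in s -> creaM A i (words A s) = 0.
Proof.
by case/splitPr => s1 s2; rewrite words_insert linearZ /= creaM2 scaler0.
Qed.

Lemma pull_is_linear A : linear (pull A : ext -> ext).
Proof.
move=> c x y; rewrite /pull scaler_sumr -big_split; apply: eq_bigr => I _ /=.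
by rewrite extD extZ scalerDl scalerA.
Qed.
HB.instance Definition _ A :=
  GRing.isLinear.Build R[i] ext ext *:%R (pull A : ext -> ext) (pull_is_linear A).

Lemma pull_words A x : pull A x = \sum_K x K *: words A (enum K).
Proof.
apply: eq_bigr => K _; congr (_ *: _).
elim: (enum K) => [|a s IH]; first by rewrite big_nil.
rewrite big_cons IH wedge_suml; apply: eq_bigr => i _.
by rewrite wedgeZl wedge_dx.
Qed.

Lemma pull_basis A K : pull A (basis_form R K) = words A (enum K).
Proof.
rewrite pull_words (bigD1 K) //= big1 ?addr0 => [|J /negPf JK].
  by rewrite ffunE eqxx scale1r.
by rewrite ffunE JK scale0r.
Qed.

Lemma pull_one A : pull A one = one.
Proof. by rewrite pull_basis finset.enum_set0. Qed.

Lemma linear_ext_basis (f g : {linear ext -> ext}) :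
  (forall K, f (basis_form R K) = g (basis_form R K)) -> f =1 g.
Proof.
move=> fg x; rewrite [x]ext_basis !linear_sum; apply: eq_bigr => K _.
by rewrite !linearZ fg.
Qed.

(** Multiplicativity of the pull-back, checked on basis forms. If i lies in K, both sides vanish,
    one of them because a word repeats i; otherwise moving i to its place in the sorted list costs
    the same sign on both sides. *)
Lemma pull_crea A i x : pull A (crea i x) = creaM A i (pull A x).
Proof.
move: x; apply: (@linear_ext_basis (pull A \o crea i) (creaM A i \o pull A)) => K /=.
rewrite pull_basis crea_basis; case: ifPn => iK.
  by rewrite linear0 words_mem // mem_enum.
have iU : i \in i |: K by rewrite finset.setU11.
have := enum_setD1 i (i |: K); rewrite finset.setU1K // => ->.
rewrite linearZ /= pull_basis remE -sgn_ins_setU1_id sgn_ins_index //.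
rewrite -[in words A (enum _)](cat_take_drop (index i (enum (i |: K))) (enum _)).
rewrite (drop_nth i) ?index_mem ?mem_enum // nth_index ?mem_enum //.
rewrite words_insert size_takel ?index_size // scalerA -expr2 sqrr_sign.
by rewrite scale1r.
Qed.

End PullBack.

(** * The Hodge star in coordinates and its Gram determinants *)

Section HodgeStar.
Variables (R : realType) (m : nat).
Local Notation ext := (exterior R m).
Implicit Types (i j l : 'I_m) (I J K : {set 'I_m}) (x y : ext) (A B h g : 'M[R]_m).
Local Notation crea := (@crea R m).
Local Notation anni := (@anni R m).
Local Notation creaM := (mixM crea).
Local Notation one := (one_form R m).

Lemma anni_creaM A i j x :
  anni i (creaM A j x) = (A i j)%:C%C *: x - creaM A j (anni i x).
Proof.
rewrite /mixM linear_sum /= (bigD1 i) //= [X in _ = _ - X](bigD1 i) //=.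
rewrite opprD addrA -sumrN linearZ /= anni_crea eqxx scale1r scalerBr.
congr (_ + _); apply: eq_bigr => l li.
by rewrite linearZ /= anni_crea eq_sym (negPf li) scale0r sub0r scalerN.
Qed.

(** Contracting a pull-back with the i-th coordinate vector contracts the form with the image of
    that vector, which is row i of A. *)
Lemma anni_pull A i x :
  anni i (pull A x) = \sum_l (A i l)%:C%C *: pull A (anni l x).
Proof.
move: x; apply: ext_ind => [|c x IH|x y IHx IHy|j x IH].
- rewrite pull_one anni_one big1 // => l _.
  by rewrite anni_one linear0 scaler0.
- rewrite !linearZ /= IH scaler_sumr; apply: eq_bigr => l _.
  by rewrite !linearZ /= !scalerA mulrC.
- rewrite !linearD /= IHx IHy -big_split; apply: eq_bigr => l _ /=.
  by rewrite !linearD.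
rewrite pull_crea anni_creaM IH (linear_sum (creaM A j)) /=.
rewrite [RHS](eq_bigr (fun l => (A i l)%:C%C *: ((l == j)%:R *: pull A x)
  - (A i l)%:C%C *: creaM A j (pull A (anni l x)))); last first.
  move=> l _; rewrite anni_crea -scalerBr; congr (_ *: _).
  by rewrite linearB /= linearZ /= pull_crea.
rewrite big_split sumrN /=; congr (_ + - _); last first.
  by apply: eq_bigr => l _; rewrite linearZ.
rewrite (bigD1 j) //= big1 ?addr0 ?eqxx ?scale1r // => l /negPf ->.
by rewrite scale0r scaler0.
Qed.

Lemma pull_mul A B x : pull A (pull B x) = pull (A *m B) x.
Proof.
move: x; apply: (@linear_ext_crea _ _ (pull A \o pull B) (pull (A *m B))) => /=.
  by rewrite !pull_one.
move=> i x IH; rewrite !pull_crea -IH mixM_mul {1}/mixM linear_sum /=.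
by apply: eq_bigr => l _; rewrite linearZ /= pull_crea.
Qed.

Lemma pull1 x : pull 1%:M x = x.
Proof.
move: x; apply: (@linear_ext_crea _ _ (pull 1%:M) idfun) => [|i x /= IH].
  exact: pull_one.
by rewrite pull_crea mixM_scalar scale1r IH.
Qed.

(** Carries the sign (-1) ^ degree on forms that need not be homogeneous. *)
Definition parity x : ext := [ffun K : {set 'I_m} => (-1) ^+ #|K| * x K].

Lemma parity_is_linear : linear parity.
Proof. by move=> c x y; apply/ffunP => K; rewrite extD extZ !ffunE mulrDr mulrCA. Qed.
HB.instance Definition _ :=
  GRing.isLinear.Build R[i] ext ext *:%R parity parity_is_linear.

Lemma parityK x : parity (parity x) = x.
Proof. by apply/ffunP => K; rewrite !ffunE mulrA -expr2 sqrr_sign mul1r. Qed.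

Lemma parity_one : parity one = one.
Proof.
apply/ffunP => K; rewrite !ffunE.
by case: eqP => [->|_]; rewrite ?mulr0 // finset.cards0 mulr1.
Qed.

Lemma parity_crea i x : parity (crea i x) = - crea i (parity x).
Proof.
apply/ffunP => K; rewrite extN !ffunE; case: ifPn => iK; last by rewrite mulr0 oppr0.
by rewrite (cardsD1 i K) iK exprS; ring.
Qed.

Lemma parity_homogeneous k x : homogeneous k%:Z x -> parity x = (-1) ^+ k *: x.
Proof.
move=> hx; apply/ffunP => K; rewrite extZ !ffunE.
have [[->]//|/eqP /hx ->] := #|K|%:Z =P k%:Z.
by rewrite !mulr0.
Qed.

(** Since -1 is central, [parity] commutes with every pull-back; since J squares to -1, it is also
    the square of the algebra map induced by J. *)
Lemma pullN1 x : pull (- 1)%:M x = parity x.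
Proof.
move: x; apply: (@linear_ext_crea _ _ (pull (- 1)%:M) parity) => [|i x /= IH].
  by rewrite /= pull_one parity_one.
by rewrite pull_crea mixM_scalar parity_crea IH rmorphN rmorph1 scaleN1r.
Qed.

Lemma parity_pull A x : parity (pull A x) = pull A (parity x).
Proof. by rewrite -!pullN1 !pull_mul scalar_mxC. Qed.

(** Expansion along the first column is the recursion defining [words]: the row of i is deleted
    together with i from I, and the cofactor sign is the position of i in [enum I]. The index x0 is
    only the default of [nth]. *)
Lemma words_det h (x0 : 'I_m) (s : seq 'I_m) k I : size s = k -> #|I| = k ->
  words h s I =
    (\det (\matrix_(a < k, b < k) h (nth x0 (enum I) a) (nth x0 s b)))%:C%C.
Proof.
elim: s k I => [|j s IH] k I /= <- {k} => [/eqP|cI].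
  by rewrite cards_eq0 det_mx00 => /eqP ->; rewrite ffunE eqxx.
rewrite (expand_det_col _ ord0) rmorph_sum /mixM ext_sum /=.
transitivity (\sum_(i in I) (h i j)%:C%C * (sgn_ins R i I * words h s (I :\ i))).
  rewrite [RHS]big_mkcond; apply: eq_bigr => i _.
  by rewrite extZ ffunE; case: ifP; rewrite ?mulr0.
have sz : size (enum I) = (size s).+1 by rewrite -cardE.
rewrite -big_enum /= (big_nth x0) sz big_mkord; apply: eq_bigr => a _ /=.
have aI : (a < size (enum I))%N by rewrite sz.
have iI : nth x0 (enum I) a \in I by rewrite -mem_enum mem_nth.
rewrite rmorphM mxE; congr (_ * _).
have cI' : #|I :\ nth x0 (enum I) a| = size s.
  by move: cI; rewrite (cardsD1 (nth x0 (enum I) a)) iI => -[].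
rewrite (IH _ _ erefl cI') /cofactor rmorphM rmorph_sign addn0 sgn_ins_index //.
rewrite index_uniq ?enum_uniq //; congr (_ * _%:C%C); congr (\det _).
apply/matrixP => u v; rewrite !mxE /=; congr (h _ _).
rewrite enum_setD1 remE index_uniq ?enum_uniq // nth_cat size_takel ?(ltnW aI) //.
rewrite /bump; case: ltnP => ua; first by rewrite nth_take // leqNgt ua.
by rewrite nth_drop addSn subnKC.
Qed.

Lemma words_card h (s : seq 'I_m) I : #|I| != size s -> words h s I = 0.
Proof.
elim: s I => [|j s IH] I /=; first by rewrite cards_eq0 ffunE => /negPf ->.
move=> cI; rewrite /mixM ext_sum big1 // => i _; rewrite extZ ffunE.
case: ifP => iI; rewrite ?IH ?mulr0 //.
by move: cI; rewrite (cardsD1 i) iI.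
Qed.

Lemma minor_words h I J : (minor h I J)%:C%C = words h (enum J) I.
Proof.
rewrite /minor; case: eqP => [e|/eqP ne]; last first.
  by rewrite words_card // -cardE eq_sym.
(* A nonempty J supplies the default index; for empty J both sides are 1. *)
have [x0 _|J0] := pickP (mem J).
  rewrite (words_det _ x0 (k := #|J|)) -?cardE //; congr (\det _)%:C%C.
  by apply/matrixP => a b; rewrite !mxE !(enum_val_nth x0).
have {J0} J0 : J = finset.set0 by apply/setP => i; rewrite finset.in_set0; exact: J0.
have det0 d (M : 'M[R]_d) : d = 0%N -> \det M = 1.
  by move=> d0; move: M; rewrite d0 => M; rewrite det_mx00.
have cJ : #|J| = 0%N by rewrite J0 finset.cards0.
have /eqP I0 : I == finset.set0 by rewrite -cards_eq0 -e cJ.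
by rewrite det0 // J0 I0 finset.enum_set0 /= ffunE eqxx.
Qed.

Lemma inner_basis g I x :
  inner g (basis_form R I) (conj_form x) = pull (invmx g) x I.
Proof.
rewrite /inner (bigD1 I) //= [X in _ + X]big1 ?addr0 => [|J /negPf JI].
  rewrite pull_words ext_sum; apply: eq_bigr => J _.
  by rewrite extZ !ffunE eqxx mul1r conjcK minor_words mulrC.
by apply: big1 => K _; rewrite ffunE JI mul0r mulr0.
Qed.

(* The star of the coordinate metric on R^m; that of g is its composition with
   pull (invmx g), up to the factor vol (hodge_starE). *)
Definition flat_star x : ext :=
  [ffun K : {set 'I_m} => (-1) ^+ inversions (~: K) K * x (~: K)].

Lemma flat_star_is_linear : linear flat_star.
Proof. by move=> c x y; apply/ffunP => K; rewrite extD extZ !ffunE mulrDr mulrCA. Qed.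
HB.instance Definition _ :=
  GRing.isLinear.Build R[i] ext ext *:%R flat_star flat_star_is_linear.

Lemma inversionsUr I J K : [disjoint J & K] ->
  inversions I (J :|: K) = (inversions I J + inversions I K)%N.
Proof.
move=> JK; rewrite /inversions -big_split /=; apply: eq_bigr => i _.
by rewrite -bigU //; apply: eq_bigl => l; rewrite finset.in_setU.
Qed.

Lemma inversions_swap i K : i \notin K ->
  (inversions [set i]%SET K + inversions K [set i]%SET)%N = #|K|.
Proof.
move=> iK; rewrite inversions1E /inversions -big_split /= -sum1_card.
apply: eq_bigr => l lK; rewrite big_set1.
by case: ltngtP => // /ord_inj e; rewrite -e lK in iK.
Qed.

(** The two inversion counts differ by moving i past N, the complement of K without i; this costs
    (-1) ^ #|N|, which [parity] supplies. *)
Lemma flat_star_crea i x : flat_star (crea i x) = anni i (flat_star (parity x)).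
Proof.
apply/ffunP => K; rewrite !ffunE finset.in_setC; case: (boolP (i \in K)) => iK /=.
  by rewrite mulr0.
have -> : ~: (i |: K) = ~: K :\ i.
  by apply/setP => l; rewrite !inE negb_or.
set N := ~: K :\ i; have iN : i \notin N by rewrite finset.setD11.
have -> : ~: K = i |: N by rewrite finset.setD1K ?finset.in_setC.
rewrite inversionsUl ?disjoints1 // inversionsUr ?disjoints1 // !exprD sgn_ins_setU1_id.
rewrite -(inversions_swap iN) exprD -!/(sgn_ins R _ _).
rewrite mulrACA; set a := (-1) ^+ inversions N [set i]%SET.
have aa : a * a = 1 by rewrite -expr2 sqrr_sign.
by rewrite -[LHS]mul1r -{1}aa; ring.
Qed.

(** Testing the defining property on the basis form of [~: K] and reading off the top coefficient
    isolates the coefficient of the star at K. *)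
Lemma hodge_starE g (vol : ext) x : homogeneous m vol ->
  hodge_star g vol x = vol finset.setT *: flat_star (pull (invmx g) x).
Proof.
move=> hvol; apply/ffunP => K.
have kK : (#|~: K| <= m)%N by rewrite -[X in (_ <= X)%N]card_ord max_card.
have hb : homogeneous #|~: K| (basis_form R (~: K)).
  by move=> I; rewrite ffunE; case: (I =P _) => [->|//]; rewrite eqxx.
have /ffunP /(_ finset.setT) := hodge_starP g x hvol kK hb.
rewrite wedge_basis finset.subsetT finset.setTD finset.setCK extZ inner_basis.
rewrite [hpart _ _ _]ffunE card_compl eqxx extZ ffunE => e.
apply: (mulfI (x := (-1) ^+ inversions (~: K) K)); first by rewrite signr_eq0.
by rewrite e mulrCA [X in _ = _ * X]mulrA -expr2 sqrr_sign mul1r mulrC.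
Qed.

End HodgeStar.

(** * Quadratic operators *)

Section QuadraticOperators.
Variables (R : realType) (m : nat).
Local Notation ext := (exterior R m).
Implicit Types (i j k l : 'I_m) (x y : ext) (A B W : 'M[R]_m).
Implicit Types f : 'I_m -> {linear ext -> ext}.
Local Notation crea := (@crea R m).
Local Notation anni := (@anni R m).
Local Notation one := (one_form R m).

(** For antisymmetric W, half of this is the wedge with the 2-form of matrix W when f is [crea], and
    up to sign a contraction with a bivector when f is [anni]. *)
Definition quad f W x : ext := \sum_j mixM f W j (f j x).

Lemma quad_is_linear f W : linear (quad f W).
Proof.
move=> c x y; rewrite /quad scaler_sumr -big_split; apply: eq_bigr => i _ /=.
by rewrite !linearP.
Qed.
HB.instance Definition _ f W :=
  GRing.isLinear.Build R[i] ext ext *:%R (quad f W) (quad_is_linear f W).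

Lemma quadE f W x : quad f W x = \sum_i \sum_j (W i j)%:C%C *: f i (f j x).
Proof. by rewrite exchange_big. Qed.

Lemma quad_mixM f A W x :
  \sum_i \sum_j (W i j)%:C%C *: mixM f A i (mixM f A j x) =
  quad f (A *m W *m A^T) x.
Proof.
rewrite exchange_big.
transitivity (\sum_j mixM f (A *m W) j (mixM f A j x)).
  by apply: eq_bigr => j _; rewrite mixM_mul.
transitivity (\sum_j \sum_l (A l j)%:C%C *: mixM f (A *m W) j (f l x)).
  apply: eq_bigr => j _; rewrite [mixM f A j x]/mixM linear_sum.
  by apply: eq_bigr => l _; rewrite linearZ.
rewrite exchange_big; apply: eq_bigr => l _; rewrite mixM_mul.
by apply: eq_bigr => j _; rewrite [A^T _ _]mxE.
Qed.

Lemma anni_quad_crea W l x :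
  anni l (quad crea W x) =
  mixM crea W^T l x - mixM crea W l x + quad crea W (anni l x).
Proof.
rewrite /quad linear_sum /=.
have E j : anni l (mixM crea W j (crea j x)) =
    (W l j)%:C%C *: crea j x - (l == j)%:R *: mixM crea W j x
    + mixM crea W j (crea j (anni l x)).
  rewrite anni_creaM anni_crea.
  by rewrite linearB /= linearZ /= opprB addrA addrAC.
under eq_bigr do rewrite E.
rewrite !big_split /=; congr (_ + _ + _).
  by rewrite /mixM; apply: eq_bigr => j _; rewrite [W^T _ _]mxE.
rewrite sumrN; congr (- _).
rewrite (bigD1 l) //= eqxx scale1r big1 ?addr0 // => j /negPf.
by rewrite eq_sym => ->; rewrite scale0r.
Qed.

Lemma quad_anni_pull W A x :
  quad anni W (pull A x) = pull A (quad anni (A^T *m W *m A) x).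
Proof.
have annipull i y : anni i (pull A y) = pull A (mixM anni A^T i y).
  rewrite anni_pull linear_sum; apply: eq_bigr => l _ /=.
  by rewrite linearZ /= [A^T _ _]mxE.
have -> : A^T *m W *m A = A^T *m W *m (A^T)^T by rewrite trmxK.
rewrite -quad_mixM quadE linear_sum.
apply: eq_bigr => i _; rewrite linear_sum; apply: eq_bigr => j _ /=.
by rewrite !annipull linearZ.
Qed.

Lemma quad_crea_pull W A x :
  pull A (quad crea W x) = quad crea (A *m W *m A^T) (pull A x).
Proof.
rewrite -quad_mixM quadE linear_sum.
apply: eq_bigr => i _; rewrite linear_sum; apply: eq_bigr => j _ /=.
by rewrite linearZ /= !pull_crea.
Qed.

Lemma quad_anni_anni W l x :
  quad anni W (anni l x) = anni l (quad anni W x).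
Proof.
rewrite !quadE linear_sum; apply: eq_bigr => i _.
rewrite linear_sum; apply: eq_bigr => j _ /=.
by rewrite linearZ /= (anniC j l) linearN /= (anniC i l) opprK.
Qed.

Lemma quad_crea_crea W l x :
  quad crea W (crea l x) = crea l (quad crea W x).
Proof.
rewrite !quadE linear_sum; apply: eq_bigr => i _.
rewrite linear_sum; apply: eq_bigr => j _ /=.
by rewrite linearZ /= (creaC j l) linearN /= (creaC i l) opprK.
Qed.

(** The degree operator, as [numberE] shows. *)
Definition number x : ext := \sum_i crea i (anni i x).

Lemma numberE (k : nat) x : homogeneous k%:Z x -> number x = k%:R *: x.
Proof.
move=> hx; apply/ffunP => K; rewrite ext_sum extZ.
transitivity (\sum_(i in K) x K).
  rewrite [RHS]big_mkcond; apply: eq_bigr => i _; rewrite !ffunE.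
  case: ifP => // iK; rewrite finset.setD11 finset.setD1K // sgn_ins_setD1_id.
  by rewrite mulrA sgn_insK mul1r.
have [[<-]|/eqP /hx ->] := #|K|%:Z =P k%:Z; last by rewrite mulr0 big1.
by rewrite sumr_const mulr_natl.
Qed.

(** The relation [Lambda, L] before normalization. Moving two contractions past the quadratic
    operator leaves three sums: [S1] and [S3] give the degree operator because W V = -1, and [S2]
    gives the trace of the identity. *)
Lemma quad_commutator V W x : V^T = - V -> W^T = - W -> V *m W = (-1)%:M ->
  quad anni V (quad crea W x) = quad crea W (quad anni V x)
    + 4%:R *: number x - (2 * m)%:R *: x.
Proof.
move=> VT WT VW.
have annL l y : anni l (quad crea W y) =
    quad crea W (anni l y) - 2%:R *: mixM crea W l y.
  by rewrite anni_quad_crea WT mixMN addrC -opprD scaler_nat.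
have E k l : anni k (anni l (quad crea W x)) =
   quad crea W (anni k (anni l x)) -
     2%:R *: (mixM crea W k (anni l x) + (W k l)%:C%C *: x - mixM crea W l (anni k x)).
  rewrite annL linearB /= annL [anni k (_ *: _)]linearZ /= anni_creaM.
  by rewrite -addrA -opprD -scalerDr addrA.
rewrite [in LHS]quadE /=.
under eq_bigr => k _ do under eq_bigr => l _ do rewrite E scalerBr.
under eq_bigr do rewrite big_split sumrN /=.
rewrite big_split sumrN /= -addrA; congr (_ + _).
  rewrite [in RHS](quadE _ V) linear_sum; apply: eq_bigr => k _.
  by rewrite linear_sum; apply: eq_bigr => l _; rewrite [in RHS]linearZ.
have WV : W *m V = (- 1)%:M.
  have /mulmx1C : V *m - W = 1%:M by rewrite mulmxN VW -raddfN opprK.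
  by rewrite mulNmx => e; rewrite -[LHS]opprK e raddfN.
have S1 : \sum_k \sum_l (V k l)%:C%C *: mixM crea W k (anni l x) = - number x.
  rewrite exchange_big -sumrN; apply: eq_bigr => l _.
  by rewrite -mixM_mul WV mixM_scalar rmorphN rmorph1 scaleN1r.
have S3 : \sum_k \sum_l (V k l)%:C%C *: mixM crea W l (anni k x) = number x.
  apply: eq_bigr => k _; transitivity (mixM crea (W *m V^T) k (anni k x)).
    by rewrite mixM_mul; apply: eq_bigr => l _; rewrite mxE.
  by rewrite VT mulmxN WV -raddfN opprK mixM_scalar rmorph1 scale1r.
have S2 : \sum_k \sum_l (V k l)%:C%C *: ((W k l)%:C%C *: x) = m%:R *: x.
  have -> : m%:R = (\tr (V *m W^T))%:C%C :> R[i].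
    by rewrite WT mulmxN VW -raddfN opprK mxtrace1 rmorph_nat.
  rewrite rmorph_sum scaler_suml; apply: eq_bigr => k _.
  rewrite mxE rmorph_sum scaler_suml; apply: eq_bigr => l _.
  by rewrite [W^T _ _]mxE rmorphM scalerA.
transitivity (- (2%:R *: (- number x + m%:R *: x - number x))).
  rewrite -{1}S1 -S3 -S2 -big_split -sumrB scaler_sumr /=; congr (- _).
  apply: eq_bigr => k _; rewrite -big_split -sumrB scaler_sumr /=.
  apply: eq_bigr => l _.
  by rewrite -scalerDr -scalerBr scalerA mulrC -scalerA.
by apply/ffunP => K; rewrite !(extD, extN, extZ) natrM; ring.
Qed.

End QuadraticOperators.

(** * Degrees and signs *)

Section Homogeneous.
Variables (R : realType) (m : nat).
Local Notation ext := (exterior R m).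
Implicit Types (k : int) (x y : ext).

Lemma homogeneousZ k (c : R[i]) x : homogeneous k x -> homogeneous k (c *: x).
Proof. by move=> hx I Ik; rewrite extZ hx ?mulr0. Qed.

Lemma homogeneous_sum k (T : Type) (r : seq T) (P : pred T) (F : T -> ext) :
  (forall t, homogeneous k (F t)) -> homogeneous k (\sum_(t <- r | P t) F t).
Proof. by move=> hF I Ik; rewrite ext_sum big1 // => t _; apply: hF. Qed.

Lemma homogeneous_crea k i x : homogeneous k x -> homogeneous (k + 1) (crea i x).
Proof.
move=> hx I; rewrite ffunE; case: ifP => // iI Ik; rewrite hx ?mulr0 //.
by apply: contraNneq Ik => <-; rewrite (cardsD1 i) iI add1n intS addrC.
Qed.

Lemma homogeneous_anni k i x : homogeneous (k + 1) x -> homogeneous k (anni i x).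
Proof.
move=> hx I; rewrite ffunE; case: ifPn => // iI Ik; rewrite hx ?mulr0 //.
rewrite cardsU1 iI add1n intS addrC; apply: contraNneq Ik => /addIr ->.
by rewrite eqxx.
Qed.

Lemma homogeneous_mixM_crea k (A : 'M[R]_m) i x :
  homogeneous k x -> homogeneous (k + 1) (mixM (@crea R m) A i x).
Proof.
by move=> hx; apply: homogeneous_sum => l; apply/homogeneousZ/homogeneous_crea.
Qed.

Lemma homogeneous_one : homogeneous 0 (one_form R m).
Proof.
by move=> I; rewrite ffunE; case: (I =P _) => // ->; rewrite finset.cards0 eqxx.
Qed.

Lemma homogeneous_eq0 k x : homogeneous k x -> (k < 0) || (m%:Z < k) -> x = 0.
Proof.
move=> hx hk; apply/ffunP => I; rewrite ext0 hx //.
have : (#|I| <= m)%N by rewrite -[X in (_ <= X)%N]card_ord max_card.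
by apply: contraTneq => e; move: hk; rewrite -e ltz_nat ltnNge.
Qed.

End Homogeneous.

(** * Contractions under the star in even dimension *)

Section FlatStar.
Variables (R : realType) (m : nat).
Hypothesis even_m : ~~ odd m.
Local Notation ext := (exterior R m).
Implicit Types (K : {set 'I_m}) (x y : ext).

Lemma signC K : (-1) ^+ #|~: K| = (-1) ^+ #|K| :> R[i].
Proof.
rewrite -[LHS]signr_odd -[RHS]signr_odd.
have /(congr1 odd) := cardsC K; rewrite card_ord (negPf even_m) oddD.
by case: (odd _); case: (odd _).
Qed.

Lemma parity_flat_star x : parity (flat_star x) = flat_star (parity x).
Proof. by apply/ffunP => K; rewrite !ffunE signC; ring. Qed.

(** The counterpart of [flat_star_crea]; evenness of m lets the size of [~: K] be exchanged for that
    of K in the sign. *)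
Lemma flat_star_anni i x : flat_star (anni i x) = parity (crea i (flat_star x)).
Proof.
apply/ffunP => K; rewrite !ffunE finset.in_setC; case: (boolP (i \in K)) => iK /=;
  last by rewrite !mulr0.
have -> : ~: (K :\ i) = i |: ~: K.
  by apply/setP => l; rewrite !inE negb_and negbK.
set N := K :\ i; have iN : i \notin N by rewrite finset.setD11.
have iC : i \notin ~: K by rewrite finset.in_setC iK.
have KE : K = i |: N by rewrite finset.setD1K.
have -> : inversions (~: K) K = (inversions (~: K) [set i]%SET + inversions (~: K) N)%N.
  by rewrite [in X in inversions _ X]KE inversionsUr ?disjoints1.
rewrite inversionsUl ?disjoints1 // !exprD -!/(sgn_ins R _ _) -signC sgn_ins_setD1_id.
rewrite -(inversions_swap iC) exprD -!/(sgn_ins R _ _).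
set a := sgn_ins R i K.
have aa : a * a = 1 by exact: sgn_insK.
set b := sgn_ins R i (~: K).
set c := (-1) ^+ inversions (~: K) [set i]%SET.
rewrite -[LHS]mul1r -{1}aa; ring.
Qed.

End FlatStar.

Section PullAnni.
Variables (R : realType) (m : nat).
Local Notation creaM := (mixM (@crea R m)).
Implicit Types (x : exterior R m) (A B : 'M[R]_m).

(** Solves [anni_pull] for the contraction inside the pull-back, by means of the left inverse B. *)
Lemma pull_anni A B j x : B *m A = 1%:M ->
  pull A (anni j x) = \sum_i (B j i)%:C%C *: anni i (pull A x).
Proof.
move=> BA; under eq_bigr => i _ do rewrite anni_pull scaler_sumr.
have BAE l : \sum_i (B j i)%:C%C * (A i l)%:C%C = (j == l)%:R :> R[i].
  rewrite (eq_bigr (fun i => (B j i * A i l)%:C%C)) => [|i _]; last first.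
    by rewrite rmorphM.
  have := congr1 (fun X : 'M[R]_m => (X j l)%:C%C : R[i]) BA.
  by rewrite !mxE rmorph_sum rmorph_nat.
rewrite exchange_big /=.
transitivity (\sum_l (j == l)%:R *: pull A (anni l x)).
  rewrite (bigD1 j) //= eqxx scale1r big1 ?addr0 // => l /negPf.
  by rewrite eq_sym => ->; rewrite scale0r.
apply: eq_bigr => l _; rewrite -BAE scaler_suml.
by apply: eq_bigr => i _; rewrite scalerA.
Qed.

Lemma flat_star_pull_anni A B j x : ~~ odd m -> B *m A = 1%:M ->
  flat_star (pull A (anni j x)) = parity (creaM B^T j (flat_star (pull A x))).
Proof.
move=> even_m BA; rewrite (pull_anni _ _ BA) (linear_sum (@flat_star R m)).
rewrite /mixM (linear_sum (@parity R m)); apply: eq_bigr => i _ /=.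
by rewrite !linearZ /= flat_star_anni // [B^T _ _]mxE.
Qed.

End PullAnni.

(** * Linear algebra of a Hermitian tangent space *)

Definition hermitian_pair (R : realType) (m : nat) (Jm g : 'M[R]_m) : Prop :=
  [/\ Jm *m Jm = (- 1)%:M, g^T = g,
      forall v : 'rV[R]_m, v != 0 -> 0 < (v *m g *m v^T) 0 0
    & Jm *m g *m Jm^T = g].

Section HermitianVectorSpace.
Variables (R : realType) (n : nat).
Local Notation m := n.*2.
Local Notation ext := (exterior R m).
Variables (Jm g : 'M[R]_m).
Hypothesis Jg_hermitian : hermitian_pair Jm g.
Implicit Types (i j k : 'I_m) (x y : ext).
Local Notation crea := (@crea R m).
Local Notation anni := (@anni R m).
Local Notation creaM := (mixM crea).
Local Notation one := (one_form R m).
Local Notation parity := (@parity R m).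
Local Notation h := (invmx g).
Local Notation W := (Jm *m g).
Local Notation V := (h *m Jm).

Let JJ : Jm *m Jm = (- 1)%:M. Proof. by case: Jg_hermitian. Qed.
Let g_sym : g^T = g. Proof. by case: Jg_hermitian. Qed.
Let g_pos (v : 'rV[R]_m) : v != 0 -> 0 < (v *m g *m v^T) 0 0.
Proof. by case: Jg_hermitian => _ _ h _; exact: h. Qed.
Let JgJ : Jm *m g *m Jm^T = g. Proof. by case: Jg_hermitian. Qed.

Lemma g_unit : g \in unitmx.
Proof.
rewrite -row_free_unit -kermx_eq0; apply/negPn/negP => /rowV0Pn[v vker v0].
have /sub_kermxP vg : (v <= kermx g)%MS := vker.
by have := g_pos v0; rewrite vg mul0mx mxE ltxx.
Qed.

Let hg : h *m g = 1%:M. Proof. exact: mulVmx g_unit. Qed.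
Let gh : g *m h = 1%:M. Proof. exact: mulmxV g_unit. Qed.
Let h_sym : h^T = h. Proof. by rewrite trmx_inv g_sym. Qed.

Let JN : Jm *m - Jm = 1%:M.
Proof. by rewrite mulmxN JJ -raddfN opprK. Qed.

Lemma J_unit : Jm \in unitmx.
Proof. by have [] := mulmx1_unit JN. Qed.

Let gJT : g *m Jm^T = - W.
Proof.
have := congr1 (mulmx (- Jm)) JgJ.
by rewrite !mulmxA (mulmx1C JN) mul1mx mulNmx.
Qed.

Let W_anti : W^T = - W.
Proof. by rewrite trmx_mul g_sym gJT. Qed.

Let JTh : Jm^T *m h = - V.
Proof.
have := congr1 (fun X => h *m X *m h) gJT.
by rewrite mulmxN mulNmx !mulmxA hg mul1mx -[h *m Jm *m g *m h]mulmxA gh mulmx1.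
Qed.

Let V_anti : V^T = - V.
Proof. by rewrite trmx_mul h_sym JTh. Qed.

Let VW : V *m W = (- 1)%:M.
Proof.
by rewrite mulmxA -[V *m Jm]mulmxA JJ mul_mx_scalar scaleN1r mulNmx hg raddfN.
Qed.

Let hWh : h *m W *m h^T = V.
Proof. by rewrite h_sym -!mulmxA gh mulmx1. Qed.

Let JTVJ : Jm^T *m V *m Jm = V.
Proof. by rewrite mulmxA JTh !mulNmx -!mulmxA JJ mul_mx_scalar scaleN1r mulmxN opprK. Qed.

Let JWJT : Jm *m W *m Jm^T = W.
Proof. by rewrite -mulmxA JgJ. Qed.

(** * The operators L, Lambda and star at one point *)

Definition omega_at : ext :=
  \sum_(i < m) \sum_(j < m | (i < j)%N) (W i j)%:C%C *: wedge (dx R i) (dx R j).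

Definition vol_at : ext := (n`!%:R)^-1 *: iter n (wedge omega_at) one.

Definition lef_at x : ext := wedge omega_at x.

Lemma lef_at_is_linear : linear lef_at.
Proof. exact: wedge_is_linear. Qed.
HB.instance Definition _ :=
  GRing.isLinear.Build R[i] ext ext *:%R lef_at lef_at_is_linear.

Definition star_at x : ext := hodge_star g vol_at x.

(** Contraction with the bivector V obtained from omega by raising both indices ([hWh]).
    [hodge_star_inv_lef_star] identifies it with the conjugate of L by the star. *)
Definition lam_at x : ext := - 2%:R^-1 *: quad anni V x.

Lemma lam_at_is_linear : linear lam_at.
Proof. by move=> c x y; rewrite /lam_at linearP scalerDr !scalerA mulrC. Qed.
HB.instance Definition _ :=
  GRing.isLinear.Build R[i] ext ext *:%R lam_at lam_at_is_linear.

(** The terms with i < j and with j < i agree, as both W and the products of the [crea i] are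
    antisymmetric; hence the factor 1/2. *)
Lemma lef_atE x : lef_at x = 2%:R^-1 *: quad crea W x.
Proof.
have LE : lef_at x =
  \sum_(i < m) \sum_(j < m | (i < j)%N) (W i j)%:C%C *: crea i (crea j x).
  rewrite /lef_at /omega_at wedge_suml; apply: eq_bigr => i _.
  rewrite wedge_suml; apply: eq_bigr => j ij.
  by rewrite wedgeZl wedge_dx2.
have Wji i j : W j i = - W i j.
  have := congr1 (fun X : 'M[R]_m => X i j) W_anti.
  by rewrite [(W^T)%R _ _]mxE [(- W)%R _ _]mxE.
suff -> : quad crea W x = lef_at x + lef_at x.
  by apply/ffunP => K; rewrite extZ extD; field.
have -> : lef_at x + lef_at x =
  \sum_(i < m) \sum_(j < m | (i < j)%N) (W i j)%:C%C *: crea i (crea j x) +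
  \sum_(i < m) \sum_(j < m | (j < i)%N) (W i j)%:C%C *: crea i (crea j x).
  rewrite LE; congr (_ + _).
  rewrite (exchange_big_dep predT) //=; apply: eq_bigr => i _.
  by apply: eq_bigr => j _; rewrite creaC Wji rmorphN scaleNr scalerN opprK.
rewrite quadE -big_split; apply: eq_bigr => i _ /=.
rewrite (bigID (fun j : 'I_m => (i < j)%N)) /=; congr (_ + _).
rewrite (bigID (fun j : 'I_m => (j < i)%N)) /= [X in _ + X]big1 ?addr0.
  by apply: eq_bigl => j; case: ltngtP.
by move=> j; case: ltngtP => // /ord_inj -> _; rewrite crea2 scaler0.
Qed.

Lemma homogeneous_lef_at (k : int) x :
  homogeneous k x -> homogeneous (k + 2) (lef_at x).
Proof.
move=> hx; rewrite lef_atE; apply: homogeneousZ; apply: homogeneous_sum => j.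
have -> : k + 2 = k + 1 + 1 by rewrite -addrA.
by apply: homogeneous_mixM_crea; apply: homogeneous_crea.
Qed.

Lemma homogeneous_iter_lef_at (k : int) r x :
  homogeneous k x -> homogeneous (k + (2 * r)%:Z) (iter r lef_at x).
Proof.
move=> hx; elim: r => [|r IH] /=; first by rewrite muln0 addr0.
have -> : k + (2 * r.+1)%:Z = k + (2 * r)%:Z + 2.
  by rewrite mulnS addnC PoszD addrA.
exact: homogeneous_lef_at.
Qed.

Lemma homogeneous_vol_at : homogeneous m vol_at.
Proof.
apply: homogeneousZ; have := homogeneous_iter_lef_at (r := n) (@homogeneous_one R m).
by rewrite add0r mul2n.
Qed.

Let even_m : ~~ odd m. Proof. by rewrite odd_double. Qed.

Lemma star_atE x : star_at x = vol_at finset.setT *: flat_star (pull h x).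
Proof. exact: hodge_starE homogeneous_vol_at. Qed.

Lemma star_at_is_linear : linear star_at.
Proof. by move=> c x y; rewrite !star_atE !linearP. Qed.
HB.instance Definition _ :=
  GRing.isLinear.Build R[i] ext ext *:%R star_at star_at_is_linear.

Lemma lam_atE x : lam_at x = - 2%:R^-1 *: quad anni V x.
Proof. by []. Qed.

(* Otherwise unification unfolds these down to the wedge product. *)
Local Opaque star_at vol_at lef_at lam_at.

Lemma star_at_one : star_at one = vol_at.
Proof.
rewrite star_atE pull_one; apply/ffunP => K; rewrite extZ [flat_star _ _]ffunE [one _]ffunE.
have [->|KT] := eqVneq K finset.setT.
  by rewrite finset.setCT eqxx /inversions big_set0 mul1r mulr1.
rewrite [vol_at K]homogeneous_vol_at; last first.
  apply: contraNneq KT => -[cK].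
  by rewrite finset.eqEcard finset.subsetT cardsT card_ord cK /=.
case: (_ =P _) => [e|]; last by rewrite !mulr0.
by case/eqP: KT; rewrite -[K]finset.setCK e finset.setC0.
Qed.

Lemma star_at_crea j x :
  star_at (crea j x) = mixM anni h j (star_at (parity x)).
Proof.
rewrite !star_atE pull_crea linear_sum linearZ_LR /= scaler_sumr /mixM scaler_sumr.
apply: eq_bigr => i _.
by rewrite linearZ /= flat_star_crea -parity_pull // !scalerA mulrC.
Qed.

Lemma parity_star_at x : parity (star_at x) = star_at (parity x).
Proof.
rewrite (star_atE (parity x)) -parity_pull -parity_flat_star // star_atE.
exact: linearZ.
Qed.

Lemma star_at_anni j x : star_at (anni j x) = parity (creaM g j (star_at x)).
Proof.
rewrite !star_atE (flat_star_pull_anni _ _ even_m gh) g_sym.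
by move: (vol_at _) => v; rewrite !linearZ.
Qed.

(** Two uses of [star_at_crea] turn wedges into contractions with raised indices; the two parity
    operators leave one minus sign, the one in [lam_at]. *)
Lemma star_at_lef x : star_at (lef_at x) = lam_at (star_at x).
Proof.
rewrite lef_atE linearZ /= lam_atE scaleNr -scalerN; congr (_ *: _).
rewrite -hWh -quad_mixM quadE linear_sum -sumrN; apply: eq_bigr => i _ /=.
rewrite linear_sum -sumrN; apply: eq_bigr => j _ /=.
rewrite linearZ /= !star_at_crea parity_crea linearN /= star_at_crea parityK.
by rewrite linearN scalerN.
Qed.

(** * The sl2 relations and the square of the star *)

Lemma lam_at_lef x :
  lam_at (lef_at x) = lef_at (lam_at x) + (n%:R *: x - number x).
Proof.
rewrite !lef_atE !lam_atE !linearZ /= quad_commutator //.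
have E : (2 * m)%:R = 4%:R * n%:R :> R[i] by rewrite -muln2 mulnC -mulnA mulnC natrM.
by apply/ffunP => K; rewrite !(extD, extN, extZ) E; field.
Qed.

(** The scalar is the sum of the eigenvalues n - k - 2i of [Lambda, L] for i < j. For j = 0 it
    vanishes, so the truncated exponent is harmless. *)
Lemma lam_at_iter_lef (k j : nat) x : homogeneous k%:Z x -> lam_at x = 0 ->
  lam_at (iter j lef_at x) =
    (j%:R * (n%:R - k%:R - j%:R + 1)) *: iter (j - 1) lef_at x.
Proof.
move=> hx x0; elim: j => [|j IH]; first by rewrite mul0r scale0r.
rewrite iterS lam_at_lef IH subSS subn0.
have hj := homogeneous_iter_lef_at (r := j) hx.
rewrite -PoszD in hj; rewrite (numberE hj).
have -> : lef_at ((j%:R * (n%:R - k%:R - j%:R + 1)) *: iter (j - 1) lef_at x) =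
   (j%:R * (n%:R - k%:R - j%:R + 1)) *: iter j lef_at x.
  case: j {IH hj} => [|j]; first by rewrite !mul0r !scale0r linear0.
  by rewrite linearZ subSS subn0.
rewrite -scalerBl -scalerDl; congr (_ *: _).
by rewrite natrD natrM -natr1; ring.
Qed.

(* Downward induction on j: Lambda L^(j+1) x is a multiple of L^j x that is
   nonzero unless j = n - k, and L^j x = 0 for large j by degree. *)
Lemma iter_lef_eq0 (k j : nat) x : homogeneous k%:Z x -> lam_at x = 0 ->
  (n < k + j)%N -> iter j lef_at x = 0.
Proof.
move=> hx x0; have [d] := ubnP (m.+1 - (k + j))%N.
elim: d j => // d IH j dj nkj.
have [mj|jm] := ltnP m (k + j).
  apply: (homogeneous_eq0 (homogeneous_iter_lef_at (r := j) hx)).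
  rewrite -PoszD ltz_nat orbC; apply/orP; left; lia.
have z : iter j.+1 lef_at x = 0 by apply: IH; lia.
have := lam_at_iter_lef j.+1 hx x0; rewrite z linear0 subn1 /= => /esym/eqP.
rewrite scaler_eq0 mulf_eq0 pnatr_eq0 /= => /orP[/eqP e|/eqP //].
have : (n%:R : R[i]) = (k + j)%:R.
  by apply/eqP; rewrite -subr_eq0 -e natrD -natr1; apply/eqP; ring.
by move/eqP; rewrite eqr_nat => /eqP e'; rewrite e' ltnn in nkj.
Qed.

(** The i-th application of Lambda contributes (n - k - i + 1) i; the two families of factors
    multiply up to factorials. *)
Lemma iter_lam_iter_lef (k j : nat) x : homogeneous k%:Z x -> lam_at x = 0 ->
  (k <= n)%N -> (j <= n - k)%N ->
  iter j lam_at (iter (n - k) lef_at x) =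
    ((n - k)`!%:R * j`!%:R / (n - k - j)`!%:R) *: iter (n - k - j) lef_at x.
Proof.
move=> hx x0 kn; elim: j => [_|j IH jn].
  by rewrite subn0 fact0 mulr1 mulfV ?scale1r // pnatr_eq0 -lt0n fact_gt0.
rewrite iterS IH 1?ltnW // linearZ /= (lam_at_iter_lef _ hx x0) scalerA.
rewrite -[(n - k - j - 1)%N]subnDA addn1; congr (_ *: _).
have [p np] : exists p, (n = k + j.+1 + p)%N by exists (n - k - j.+1)%N; lia.
have -> : (n - k - j = p.+1)%N by lia.
have -> : (n - k - j.+1 = p)%N by lia.
rewrite [X in X%:R - _]np !factS !natrM !natrD -!natr1.
have : p`!%:R != 0 :> R[i] by rewrite pnatr_eq0 -lt0n fact_gt0.
have : p%:R + 1 != 0 :> R[i] by rewrite natr1 pnatr_eq0.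
by move=> ? ?; field; apply/andP.
Qed.

Lemma star_at_iter_lef (j : nat) x :
  star_at (iter j lef_at x) = iter j lam_at (star_at x).
Proof. by elim: j => [//|j IH]; rewrite !iterS star_at_lef IH. Qed.

Lemma lam_at_one : lam_at one = 0.
Proof.
by rewrite lam_atE /quad big1 ?scaler0 // => j _; rewrite /= anni_one linear0.
Qed.

Lemma iter_linear_sum (f : {linear ext -> ext}) (p : nat) (I : Type)
    (r : seq I) (P : pred I) (F : I -> ext) :
  iter p f (\sum_(i <- r | P i) F i) = \sum_(i <- r | P i) iter p f (F i).
Proof. by elim: p => [//|p IH]; rewrite (iterS p) IH linear_sum. Qed.

Lemma vol_atE : vol_at = (n`!%:R)^-1 *: iter n lef_at one.
Proof. by []. Qed.

Lemma iter_linearZ (f : {linear ext -> ext}) (p : nat) (c : R[i]) x :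
  iter p f (c *: x) = c *: iter p f x.
Proof. by elim: p => [//|p IH]; rewrite !(iterS p) IH linearZ. Qed.

(** By star L = Lambda star this is Lambda^n L^n 1 divided by n! twice, and Lambda^n L^n 1 =
    (n!)^2. *)
Lemma star_at_vol : star_at vol_at = one.
Proof.
have h1 : homogeneous 0%N one by exact: homogeneous_one.
have := iter_lam_iter_lef (j := n) h1 lam_at_one (leq0n n) (eq_leq (esym (subn0 n))).
rewrite subn0 subnn fact0 divr1 /= => e.
rewrite [X in star_at X]vol_atE linearZ /= star_at_iter_lef.
rewrite star_at_one vol_atE.
rewrite (iter_linearZ lam_at) e !scalerA; set f := n`!%:R.
have f0 : f != 0 :> R[i] by rewrite pnatr_eq0 -lt0n fact_gt0.
by rewrite mulrA mulfVK // mulVf ?scale1r.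
Qed.

Lemma star_at_mixM_anni j x :
  star_at (mixM anni h j x) = parity (crea j (star_at x)).
Proof.
transitivity (parity (creaM (g *m h) j (star_at x))); last first.
  by rewrite gh mixM_scalar rmorph1 scale1r.
rewrite mixM_mul (linear_sum star_at) (linear_sum parity).
apply: eq_bigr => i _; rewrite [LHS]linearZ [RHS]linearZ; congr (_ *: _).
exact: star_at_anni.
Qed.

(** The normalization of vol enters through the base case, star vol = 1; each [crea j] then passes
    through both stars. *)
Lemma star_at_star x : star_at (star_at x) = parity x.
Proof.
suff E : parity \o star_at \o star_at =1 idfun.
  by rewrite -[LHS]parityK; congr parity; exact: E.
apply: linear_ext_crea => [|j {}x] /=.
  by rewrite star_at_one star_at_vol parity_one.
move=> IH; rewrite star_at_crea star_at_mixM_anni parityK.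
by rewrite -parity_star_at -parity_star_at IH.
Qed.

Lemma lef_at_pull x : lef_at (pull Jm x) = pull Jm (lef_at x).
Proof. by rewrite !lef_atE linearZ /= quad_crea_pull JWJT. Qed.

Lemma lam_at_pull x : lam_at (pull Jm x) = pull Jm (lam_at x).
Proof. by rewrite !lam_atE linearZ /= quad_anni_pull JTVJ. Qed.

Lemma iter_lef_at_pull (j : nat) x :
  iter j lef_at (pull Jm x) = pull Jm (iter j lef_at x).
Proof. by elim: j => [//|j IH]; rewrite !iterS IH lef_at_pull. Qed.

Lemma iter_lam_at_pull (j : nat) x :
  iter j lam_at (pull Jm x) = pull Jm (iter j lam_at x).
Proof. by elim: j => /= [|j ->]; rewrite ?lam_at_pull. Qed.

Lemma pull_vol : pull Jm vol_at = vol_at.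
Proof.
by rewrite vol_atE linearZ /= -iter_lef_at_pull pull_one.
Qed.

Lemma mixM_anni_pull (A B : 'M[R]_m) i x :
  mixM anni B i (pull A x) = pull A (mixM anni (A^T *m B) i x).
Proof.
rewrite mixM_mul (linear_sum (pull A)); apply: eq_bigr => l _ /=.
rewrite [RHS]linearZ anni_pull; congr (_ *: _).
by rewrite (linear_sum (pull A)); apply: eq_bigr => q _; rewrite linearZ /= [A^T _ _]mxE.
Qed.

(** J preserves vol, which settles the form 1; on generators the claim becomes J^T V = g^-1. *)
Lemma star_at_pull x : star_at (pull Jm x) = pull Jm (star_at x).
Proof.
move: x; apply: (@linear_ext_crea _ _ (star_at \o pull Jm) (pull Jm \o star_at)) => /=.
  by rewrite pull_one star_at_one pull_vol.
move=> j x IH; rewrite pull_crea star_at_crea.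
rewrite [star_at _]linear_sum /=.
transitivity (mixM anni (h *m Jm) j (star_at (parity (pull Jm x)))).
  by rewrite mixM_mul; apply: eq_bigr => l _; rewrite linearZ /= star_at_crea.
have JTV : Jm^T *m V = h.
  by rewrite mulmxA JTh mulNmx -mulmxA JJ mul_mx_scalar scaleN1r opprK.
by rewrite -parity_star_at IH parity_pull parity_star_at mixM_anni_pull JTV.
Qed.

Lemma pull_J2 x : pull Jm (pull Jm x) = parity x.
Proof. by rewrite pull_mul JJ pullN1. Qed.

Lemma pull_invJK x : pull (invmx Jm) (pull Jm x) = x.
Proof. by rewrite pull_mul mulVmx ?J_unit // pull1. Qed.

Lemma pull_J_invK x : pull Jm (pull (invmx Jm) x) = x.
Proof. by rewrite pull_mul mulmxV ?J_unit // pull1. Qed.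

Lemma star_at_pull_inv x :
  star_at (pull (invmx Jm) x) = pull (invmx Jm) (star_at x).
Proof. by rewrite -[in RHS](pull_J_invK x) star_at_pull pull_invJK. Qed.

(** * The star on primitive forms *)

Lemma lam_at_anni i x : lam_at (anni i x) = anni i (lam_at x).
Proof. by rewrite !lam_atE quad_anni_anni linearZ. Qed.

Lemma lef_at_crea i x : lef_at (crea i x) = crea i (lef_at x).
Proof. by rewrite !lef_atE quad_crea_crea linearZ. Qed.

Lemma lef_at_mixM_crea (A : 'M[R]_m) i x :
  lef_at (mixM crea A i x) = mixM crea A i (lef_at x).
Proof.
rewrite (linear_sum lef_at); apply: eq_bigr => l _ /=.
by rewrite linearZ /= lef_at_crea.
Qed.

Lemma anni_lef_at i x :
  anni i (lef_at x) = lef_at (anni i x) - mixM crea W i x.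
Proof.
rewrite !lef_atE linearZ /= anni_quad_crea W_anti mixMN.
by apply/ffunP => K; rewrite !(extD, extN, extZ); field.
Qed.

Lemma anni_iter_lef_at i (j : nat) x :
  anni i (iter j.+1 lef_at x) =
  iter j.+1 lef_at (anni i x) - j.+1%:R *: mixM crea W i (iter j lef_at x).
Proof.
elim: j => [|j IH]; first by rewrite scale1r anni_lef_at.
rewrite iterS anni_lef_at IH linearB linearZ /= lef_at_mixM_crea.
by rewrite -[j.+2%:R]natr1 scalerDl scale1r opprD addrA.
Qed.

Lemma iter_lef_at_crea i (j : nat) x :
  iter j lef_at (crea i x) = crea i (iter j lef_at x).
Proof. by elim: j => /= [|j ->]; rewrite ?lef_at_crea. Qed.

(** Contracting with V instead of a coordinate vector turns the correction term of
    [anni_iter_lef_at] into a plain [crea i], because W V = -1. *)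
Lemma mixM_anni_iter_lef_at i (p : nat) x :
  mixM anni V i (iter p.+1 lef_at x) =
  iter p.+1 lef_at (mixM anni V i x) + p.+1%:R *: crea i (iter p lef_at x).
Proof.
have WV : W *m V = (- 1)%:M by rewrite -mulmxA [g *m _]mulmxA gh mul1mx JJ.
transitivity (\sum_l (V l i)%:C%C *: (iter p.+1 lef_at (anni l x)
  - p.+1%:R *: mixM crea W l (iter p lef_at x))).
  by apply: eq_bigr => l _; rewrite -anni_iter_lef_at.
under eq_bigr do rewrite scalerBr; rewrite big_split sumrN; congr (_ + _).
  rewrite (iter_linear_sum lef_at); apply: eq_bigr => l _.
  by rewrite (iter_linearZ lef_at).
move: (iter p lef_at x) (p.+1%:R) => z c.
have -> : crea i z = - mixM crea (W *m V) i z.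
  by rewrite WV mixM_scalar rmorphN rmorph1 scaleN1r opprK.
rewrite (mixM_mul crea W V i z) scalerN.
rewrite scaler_sumr; apply: congr1; apply: eq_bigr => l _.
by rewrite !scalerA mulrC.
Qed.

(* Induction on k: k x is the sum of the e_i (iota_i x), each iota_i x is
   primitive, and moving the contractions past L^(n-k+1) leaves a multiple of
   Lambda x, which is 0, and a multiple of L^(n-k) I x. *)
Lemma star_at_primitive (k : nat) x : homogeneous k%:Z x -> lam_at x = 0 ->
  (k <= n)%N -> star_at x =
  ((-1) ^+ 'C(k.+1, 2) / (n - k)`!%:R) *: pull Jm (iter (n - k) lef_at x).
Proof.
elim: k x => [|k IH] x hx x0 kn.
  have -> : x = x finset.set0 *: one.
    apply/ffunP => K; rewrite extZ ffunE.
    have [->|K0] := eqVneq K finset.set0; first by rewrite mulr1.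
    by rewrite mulr0 hx //; apply: contraNneq K0 => -[/eqP]; rewrite cards_eq0.
  move: (x _) => c; rewrite [star_at _]linearZ /= star_at_one subn0 expr0 div1r.
  rewrite -iter_lef_at_pull [pull Jm _]linearZ /= pull_one (iter_linearZ lef_at).
  by rewrite vol_atE scalerA mulrC -scalerA.
have [p np] : exists p, (n - k = p.+1)%N by exists (n - k.+1)%N; lia.
have np' : (n - k.+1 = p)%N by lia.
have hy i : homogeneous k%:Z (anni i x).
  by apply: homogeneous_anni; rewrite -PoszD addn1.
have y0 i : lam_at (anni i x) = 0 by rewrite lam_at_anni x0 linear0.
pose e : R[i] := (-1) ^+ 'C(k.+1, 2).
(* The terms where the contractions pass through L add up to a multiple of Lambda x = 0; the others
   form the degree operator, which is k + 1 on x. *)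
have E : \sum_i mixM anni V i (iter p.+1 lef_at (anni i x)) =
    (p.+1%:R * k.+1%:R) *: iter p lef_at x.
  under eq_bigr do rewrite mixM_anni_iter_lef_at.
  rewrite big_split -scaler_sumr -(iter_linear_sum lef_at).
  have -> : \sum_i mixM anni V i (anni i x) = 0.
    have /eqP := x0; rewrite lam_atE scaler_eq0 oppr_eq0 invr_eq0 pnatr_eq0.
    by move/eqP.
  have -> : iter p.+1 lef_at 0 = 0.
    by rewrite -(scale0r (0 : ext)) (iter_linearZ lef_at) !scale0r.
  rewrite [LHS]add0r -scalerA -(iter_linearZ lef_at) -(numberE hx) (iter_linear_sum lef_at).
  by congr (_ *: _); apply: eq_bigr => i _; rewrite iter_lef_at_crea.
have : k.+1%:R *: star_at x = k.+1%:R *: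
  (((-1) ^+ 'C(k.+2, 2) / (n - k.+1)`!%:R) *: pull Jm (iter (n - k.+1) lef_at x)).
  rewrite -linearZ -(numberE hx) linear_sum /=.
  transitivity (\sum_i ((-1) ^+ k * (e / (n - k)`!%:R)) *:
      mixM anni h i (pull Jm (iter p.+1 lef_at (anni i x)))).
    apply: eq_bigr => i _; rewrite star_at_crea (parity_homogeneous (hy i)).
    rewrite linearZ /= (IH _ (hy i) (y0 i)) ?(ltnW kn) // np scalerA.
    by rewrite linearZ.
  rewrite -scaler_sumr np np'.
  transitivity (((-1) ^+ k * (e / p.+1`!%:R)) *: - pull Jm
     (\sum_i mixM anni V i (iter p.+1 lef_at (anni i x)))).
    congr (_ *: _); rewrite (linear_sum (pull Jm)) -sumrN; apply: eq_bigr => i _.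
    by rewrite mixM_anni_pull JTh mixMN linearN.
  rewrite E linearZ /= -scaleNr !scalerA; congr (_ *: _).
  (* The sign (-1) ^ k comes from [parity] and one more minus from J^T g^-1 = - V; together they
     raise the binomial exponent by k + 1. *)
  have C2 : 'C(k.+2, 2) = (k.+1 + 'C(k.+1, 2))%N by rewrite binS bin1 addnC.
  rewrite C2 exprD -/e exprS factS natrM.
  have p0 : p`!%:R != 0 :> R[i] by rewrite pnatr_eq0 -lt0n fact_gt0.
  by field; rewrite p0 nat1r pnatr_eq0.
by move/(scalerI _); apply; rewrite pnatr_eq0.
Qed.

Lemma star_at_iter_lef_primitive (k j : nat) x :
  homogeneous k%:Z x -> lam_at x = 0 -> (k + j <= n)%N ->
  star_at (iter j lef_at x) =
  ((-1) ^+ 'C(k.+1, 2) * j`!%:R / (n - k - j)`!%:R) *: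
    pull Jm (iter (n - k - j) lef_at x).
Proof.
move=> hx x0 kjn; have kn : (k <= n)%N by lia.
have jn : (j <= n - k)%N by lia.
rewrite star_at_iter_lef (star_at_primitive hx x0 kn) (iter_linearZ lam_at).
rewrite iter_lam_at_pull (iter_lam_iter_lef hx x0 kn jn) [pull Jm (_ *: _)]linearZ.
rewrite scalerA; congr (_ *: _).
have f0 q : q`!%:R != 0 :> R[i] by rewrite pnatr_eq0 -lt0n fact_gt0.
by field; rewrite !f0.
Qed.

Lemma lam_at_parity x : lam_at (parity x) = parity (lam_at x).
Proof. by rewrite -!pull_J2 !lam_at_pull. Qed.

(** The chosen preimage is determined, since [star_at_star] gives both its existence and its
    uniqueness. *)
Lemma hodge_star_inv_at x : hodge_star_inv g vol_at x = parity (star_at x).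
Proof.
have starE y : hodge_star g vol_at y = star_at y by [].
rewrite /hodge_star_inv; case: xgetP => [y _ /=|/(_ (parity (star_at x)))[]].
  by rewrite starE => <-; rewrite star_at_star parityK.
by rewrite /= starE -parity_star_at star_at_star parityK.
Qed.

Lemma hodge_star_inv_lef_star x :
  hodge_star_inv g vol_at (lef_at (star_at x)) = lam_at x.
Proof.
by rewrite hodge_star_inv_at star_at_lef star_at_star lam_at_parity parityK.
Qed.

Lemma iter_linear0 (f : {linear ext -> ext}) (p : nat) : iter p f 0 = 0.
Proof. by rewrite -(scale0r (0 : ext)) iter_linearZ !scale0r. Qed.

(* The scalar c such that I star L^j x = c L^(n-k-j) x for x primitive of
   degree k, when k + j <= n. *)
Definition star_coef (k j : nat) : R[i] :=
  (-1) ^+ 'C(k.+1, 2) * j`!%:R / (n - k - j)`!%:R * (-1) ^+ k.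

(** With q + 2r = k + 1, this merges the star signs of degrees k and q into the sign (-1)^r of f. *)
Lemma sign_bin (q r : nat) :
  (-1) ^+ 'C(q + 2 * r, 2) * (-1) ^+ (q + 2 * r) * (-1) ^+ 'C(q.+1, 2) =
  (-1) ^+ r :> R[i].
Proof.
elim: r => [|r IH].
  rewrite muln0 addn0 binS bin1 exprD expr0 mulrACA -!expr2 !sqrr_sign.
  by rewrite mulr1.
have -> : (q + 2 * r.+1 = (q + 2 * r).+2)%N by lia.
set u := (q + 2 * r)%N in IH *; rewrite [(-1) ^+ r.+1]exprS -IH.
have -> : 'C(u.+2, 2) = ('C(u, 2) + u + u.+1)%N.
  by rewrite (binS u.+1 1) bin1 (binS u 1) bin1.
have aux (c v z : nat) : (-1) ^+ (c + v + v.+1) * (-1) ^+ v.+2 * (-1) ^+ z =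
    -1 * ((-1) ^+ c * (-1) ^+ v * (-1) ^+ z) :> R[i].
  have vv : (-1) ^+ v * (-1) ^+ v = 1 :> R[i] by rewrite -expr2 sqrr_sign.
  rewrite !exprD !exprS -[RHS]mulr1 -[X in _ = _ * X]vv; ring.
exact: aux.
Qed.

Lemma prod_fact (N r : nat) :
  N`!%:R * \prod_(1 <= s < r.+1) (N%:R + s%:R) = (N + r)`!%:R :> R[i].
Proof.
elim: r => [|r IH]; first by rewrite big_geq // mulr1 addn0.
by rewrite big_nat_recr //= mulrA IH addnS factS natrM -natrD addnS mulrC.
Qed.

(** Extends the coefficients by zero to r = 0, 1. For j = r = 0 this differs from [f_coef], which is
    1 there because the factorial of j + r - 1 is truncated. *)
Definition lef_coef (k j r : nat) : R[i] :=
  if (r < 2)%N then 0 else f_coef R[i] n k j r.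

Lemma lef_coefE (k j r : nat) : (0 < j + r)%N -> (k + j <= n)%N ->
  lef_coef k j r = f_coef R[i] n k j r.
Proof.
rewrite /lef_coef; case: r => [|[|//]] jr kjn /=; rewrite /f_coef.
  case: j jr kjn => // j _ kjn; rewrite addn0 subn1 /= big_geq // factS natrM.
  have f0 : j`!%:R != 0 :> R[i] by rewrite pnatr_eq0 -lt0n fact_gt0.
  by field.
have f0 : j`!%:R != 0 :> R[i] by rewrite pnatr_eq0 -lt0n fact_gt0.
by rewrite big_nat1 addnK; field.
Qed.

(** * The contribution of one Lefschetz component L^r alpha_r of d alpha *)

Section LefschetzComponent.
Variables (k q r : nat) (a : ext).
Hypothesis kqr : k.+1 = (q + 2 * r)%N.
Hypothesis ha : homogeneous q%:Z a.
Hypothesis a0 : lam_at a = 0.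

Let kq : k%:R = q%:R + 2 * r%:R - 1 :> R[i].
Proof. by rewrite -[k%:R](addrK 1) natr1 kqr natrD natrM. Qed.

(** The origin of the first summand of f, after substituting k = q + 2r - 1. *)
Lemma lam_lef_component (j : nat) :
  lam_at (iter (j + r) lef_at a)
    + (j%:R * (k%:R - n%:R + j%:R - 1)) *: iter (j + r - 1) lef_at a =
  (r%:R * (n%:R - k%:R + r%:R) - j%:R) *: iter (j + r - 1) lef_at a.
Proof.
rewrite (lam_at_iter_lef _ ha a0) -scalerDl kq natrD; congr (_ *: _); ring.
Qed.

(** The star term yields the second summand of f: the star sends L^(n-k-j+r) of a primitive q-form
    back to the exponent j + r - 1. *)
Lemma lef_component_low (j : nat) : (k + j <= n)%N ->
  lam_at (iter (j + r) lef_at a)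
    + (j%:R * (k%:R - n%:R + j%:R - 1)) *: iter (j + r - 1) lef_at a
    - star_coef k j *: pull (invmx Jm) (star_at (iter (n - k - j + r) lef_at a)) =
  lef_coef k j r *: iter (j + r - 1) lef_at a.
Proof.
(* When j = r = 0, a has degree k + 1, so L^(n-k) a = 0 and the star term vanishes. *)
move=> kjn; have [jr0|jr] := posnP (j + r).
  have [j0 r0] : j = 0%N /\ r = 0%N by lia.
  have -> : iter (n - k - j + r) lef_at a = 0.
    by apply: (iter_lef_eq0 ha a0); lia.
  rewrite [star_at 0]linear0 [pull _ 0]linear0 j0 r0.
  by rewrite /lef_coef /= !mul0r !scale0r a0 scaler0 subr0 addr0.
rewrite lam_lef_component (lef_coefE jr kjn).
rewrite (star_at_iter_lef_primitive ha a0); last by lia.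
have -> : (n - q - (n - k - j + r) = j + r - 1)%N by lia.
rewrite [pull (invmx Jm) _]linearZ /= pull_invJK scalerA -scalerBl.
congr (_ *: _); rewrite /f_coef; congr (_ + _).
have [N nN] : exists N, n = (k + j + N)%N by exists (n - k - j)%N; lia.
have NE : n%:R - k%:R - j%:R = N%:R :> R[i] by rewrite nN !natrD; ring.
have -> : (n - k - j + r = N + r)%N by lia.
rewrite /star_coef NE -prod_fact.
have -> : (n - k - j = N)%N by lia.
rewrite -(sign_bin q r) -kqr exprS.
have f0 p : p`!%:R != 0 :> R[i] by rewrite pnatr_eq0 -lt0n fact_gt0.
by field; rewrite !f0.
Qed.

(** Here the star term is absent. Unless L^(j+r-1) a = 0, the number k + j - n lies between 1 and r:
    for r = 1 the remaining coefficient is zero, and for r >= 2 the product in f has a zero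
    factor. *)
Lemma lef_component_high (j : nat) : (n < k + j)%N ->
  lam_at (iter (j + r) lef_at a)
    + (j%:R * (k%:R - n%:R + j%:R - 1)) *: iter (j + r - 1) lef_at a =
  lef_coef k j r *: iter (j + r - 1) lef_at a.
Proof.
move=> nkj; rewrite lam_lef_component.
have [z|nz] := eqVneq (iter (j + r - 1) lef_at a) 0; first by rewrite z !scaler0.
have kjr : (k + j <= n + r)%N.
  rewrite leqNgt; apply: contra_neqN nz => h; apply: (iter_lef_eq0 ha a0); lia.
have r0 : (0 < r)%N by lia.
congr (_ *: _); rewrite /lef_coef /f_coef; case: ifP => r2.
  have r1 : r = 1%N by lia.
  have e : (k + j = n.+1)%N by lia.
  have : k%:R + j%:R = n%:R + 1 :> R[i] by rewrite -natrD e natr1.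
  by move/eqP; rewrite -subr_eq => /eqP <-; rewrite r1; ring.
rewrite (bigD1_seq (k + j - n)%N) ?mem_index_iota ?iota_uniq //=; last by lia.
rewrite natrB ?(ltnW nkj) // natrD.
have -> : n%:R - k%:R - j%:R + (k%:R + j%:R - n%:R) = 0 :> R[i] by ring.
by rewrite !(mul0r, mulr0) addr0.
Qed.

End LefschetzComponent.

(* The part of [Lambda, d] L^j alpha - star I^-1 d I star L^j alpha free of
   d omega, where D is the value of d alpha. *)
Definition main_part (k j : nat) (c : R[i]) D : ext :=
  lam_at (iter j lef_at D)
    + (j%:R * (k%:R - n%:R + j%:R - 1)) *: iter (j - 1) lef_at D
    - c *: pull (invmx Jm) (star_at (iter (n - k - j) lef_at D)).

Lemma main_part_sum (k j : nat) c (I : Type) (r : seq I) (P : pred I) (F : I -> ext) :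
  main_part k j c (\sum_(i <- r | P i) F i) = \sum_(i <- r | P i) main_part k j c (F i).
Proof.
rewrite /main_part !(iter_linear_sum lef_at) (linear_sum lam_at).
rewrite (linear_sum star_at) (linear_sum (pull _)) !scaler_sumr.
by rewrite -big_split -sumrB.
Qed.

Lemma main_part0 (k j : nat) c : main_part k j c 0 = 0.
Proof.
have := main_part_sum k j c (nil : seq nat) predT (fun=> 0 : ext).
by rewrite !big_nil.
Qed.

Lemma main_part_component (k j q r : nat) a : k.+1 = (q + 2 * r)%N ->
  homogeneous q%:Z a -> lam_at a = 0 ->
  main_part k j (if (k + j <= n)%N then star_coef k j else 0) (iter r lef_at a) =
  lef_coef k j r *: iter (j + r - 1) lef_at a.
Proof.
move=> kqr ha a0; rewrite /main_part -!iterD.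
(* The two truncated exponents can differ only at j = 0, where the coefficient is zero. *)
have -> : (j%:R * (k%:R - n%:R + j%:R - 1)) *: iter (j - 1 + r) lef_at a =
    (j%:R * (k%:R - n%:R + j%:R - 1)) *: iter (j + r - 1) lef_at a.
  by case: j => [|j]; [rewrite !mul0r !scale0r | rewrite addSn !subn1].
case: leqP => kjn; first by rewrite (lef_component_low kqr ha a0 kjn).
by rewrite scale0r subr0 (lef_component_high kqr ha a0 kjn).
Qed.

Lemma main_part_lefschetz (k j : nat) (a : nat -> ext) :
  (forall r, homogeneous (k.+1%:Z - (2 * r)%:Z) (a r)) ->
  (forall r, lam_at (a r) = 0) ->
  main_part k j (if (k + j <= n)%N then star_coef k j else 0)
      (\sum_(0 <= r < k.+2) iter r lef_at (a r)) =
  \sum_(2 <= r < k.+2) f_coef R[i] n k j r *: iter (j + r - 1) lef_at (a r).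
Proof.
move=> ha a0; rewrite main_part_sum (big_nat_widenl 2 0) // [RHS]big_mkcond.
apply: eq_bigr => r _; have [kr|kr] := leqP (2 * r) k.+1.
  have kE : k.+1 = (k.+1 - 2 * r + 2 * r)%N by rewrite subnK.
  have har : homogeneous (k.+1 - 2 * r)%N%:Z (a r) by have := ha r; rewrite subzn.
  rewrite (main_part_component j kE har (a0 r)) /lef_coef.
  by case: ltnP; rewrite ?scale0r.
(* For 2r > k + 1 the component has negative degree. *)
have -> : a r = 0.
  by apply: (homogeneous_eq0 (ha r)); rewrite subr_lt0 ltz_nat kr.
by rewrite !(iter_linear0 lef_at) main_part0 scaler0 if_same.
Qed.

(** * The pointwise identity including the terms in d omega *)

Section TwistedDerivation.
Variables (T : {linear ext -> ext}) (k : nat) (x D : ext) (a : nat -> ext).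
Hypothesis lefT : forall y, lef_at (T y) = T (lef_at y).
Hypothesis hx : homogeneous k%:Z x.
Hypothesis x0 : lam_at x = 0.
Hypothesis ha : forall r, homogeneous (k.+1%:Z - (2 * r)%:Z) (a r).
Hypothesis a0 : forall r, lam_at (a r) = 0.
Hypothesis Da : D = \sum_(0 <= r < k.+2) iter r lef_at (a r).

(* The value at a point of d L^j alpha, where x and D are those of alpha and
   d alpha and T is the wedge product with d omega. *)
Definition d_iter_lef (j : nat) : ext :=
  iter j lef_at D + j%:R *: T (iter (j - 1) lef_at x).

Lemma d_iter_lefS (j : nat) :
  d_iter_lef j.+1 - lef_at (d_iter_lef j) = T (iter j lef_at x).
Proof.
rewrite /d_iter_lef subSS subn0 [lef_at (_ + _)]linearD /=.
have -> : lef_at (j%:R *: T (iter (j - 1) lef_at x)) = j%:R *: T (iter j lef_at x).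
  rewrite [LHS]linearZ /= lefT.
  by case: j => [|j]; [rewrite !scale0r | rewrite subSS subn0].
by rewrite opprD addrACA subrr add0r -scalerBl -natr1 addrAC subrr add0r scale1r.
Qed.

(** For k + j > n one has L^j x = 0, while the truncated n - k - j is 0 and L^0 x need not vanish;
    hence the explicit zero. *)
Definition star_coef_cut (j : nat) : R[i] :=
  if (k + j <= n)%N then star_coef k j else 0.

(** The left side is the value of [d*, Lambda] I L^(j+1) alpha. As Lambda star = star L and the two
    coefficients match, the terms combine into d L^N alpha - L d L^(N-1) alpha with N = n - k - j,
    which retains only d omega. *)
Lemma commutator_star (j : nat) :
  - star_at ((j.+1%:R * (n%:R - k%:R - j%:R) * star_coef_cut j) *:
      d_iter_lef (n - k - j))
  - lam_at (- star_at (star_coef_cut j.+1 *: d_iter_lef (n - k - j.+1))) =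
  - ((j.+1%:R * (n - k - j)%:R * star_coef_cut j) *:
      star_at (T (iter (n - k - j - 1) lef_at x))).
Proof.
rewrite [lam_at (- _)]linearN opprK /= -star_at_lef /star_coef_cut.
case: leqP => kj; last first.
  have -> : (k + j.+1 <= n)%N = false by lia.
  rewrite !mulr0; move: (d_iter_lef _) (d_iter_lef _) (T _) => u v w.
  by rewrite (scale0r u) (scale0r v) [lef_at 0]linear0 [star_at 0]linear0 scale0r oppr0 addr0.
have [N nN] : exists N, n = (k + j + N)%N by exists (n - k - j)%N; lia.
have -> : (n - k - j = N)%N by lia.
have -> : (n - k - j.+1 = N - 1)%N by lia.
have -> : n%:R - k%:R - j%:R = N%:R :> R[i] by rewrite nN !natrD; ring.
have -> : (k + j.+1 <= n)%N = (0 < N)%N by lia.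
case: N nN => [|N] nN /=.
  by rewrite !(mulr0, mul0r, scale0r) [lef_at 0]linear0 [star_at 0]linear0 oppr0 addr0.
have -> : star_coef k j.+1 = j.+1%:R * N.+1%:R * star_coef k j.
  rewrite /star_coef; have -> : (n - k - j = N.+1)%N by lia.
  have -> : (n - k - j.+1 = N)%N by lia.
  rewrite (factS j) (factS N) !natrM.
  have f0 : N`!%:R != 0 :> R[i] by rewrite pnatr_eq0 -lt0n fact_gt0.
  by field; rewrite f0 nat1r pnatr_eq0.
rewrite subSS subn0 -d_iter_lefS.
move: (j.+1%:R * N.+1%:R * star_coef k j) => c.
move: (d_iter_lef N.+1) (d_iter_lef N) => u v.
have -> : lef_at (c *: v) = c *: lef_at v by exact: linearZ.
have -> : star_at (u - lef_at v) = star_at u - star_at (lef_at v) by exact: linearB.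
have starZ y : star_at (c *: y) = c *: star_at y by exact: linearZ.
by rewrite !starZ scalerBr opprB addrC.
Qed.

(** The second I turns I into I^2 = [parity]; the degree k + 2(n-k-j) has the parity of k, whence
    the last factor of [star_coef]. *)
Lemma pull_star_iter_lef (j : nat) :
  pull Jm (star_at (iter j lef_at x)) = star_coef_cut j *: iter (n - k - j) lef_at x.
Proof.
rewrite /star_coef_cut; case: leqP => kj; last first.
  by rewrite (iter_lef_eq0 hx x0 kj) [star_at 0]linear0 linear0 scale0r.
rewrite (star_at_iter_lef_primitive hx x0 kj) [LHS]linearZ /= pull_J2.
have := homogeneous_iter_lef_at (r := (n - k - j)%N) hx; rewrite -PoszD => hN.
rewrite (parity_homogeneous hN) scalerA /star_coef exprD.
by rewrite [(-1) ^+ (2 * _)]exprM sqrrN expr1n expr1n mulr1.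
Qed.

Lemma star_pull_iter_lef (j : nat) :
  star_at (pull Jm (iter j lef_at x)) = star_coef_cut j *: iter (n - k - j) lef_at x.
Proof. by rewrite star_at_pull pull_star_iter_lef. Qed.

Lemma star_lam_pull_iter_lef (j : nat) :
  star_at (lam_at (pull Jm (iter j.+1 lef_at x))) =
  (j.+1%:R * (n%:R - k%:R - j%:R) * star_coef_cut j) *: iter (n - k - j) lef_at x.
Proof.
rewrite lam_at_pull (lam_at_iter_lef _ hx x0) subSS subn0.
move: (star_pull_iter_lef j); move: (iter j _ _) => u e.
have -> : n%:R - k%:R - j.+1%:R + 1 = n%:R - k%:R - j%:R :> R[i].
  by rewrite -natr1; ring.
rewrite [pull Jm (_ *: _)]linearZ /= -[RHS]scalerA -e; exact: linearZ.
Qed.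

(** The scalar bookkeeping of the final identity: u1, u3, u5 stand for the terms of [main_part], and
    u2, u4, u6 for those containing d omega. *)
Lemma linear_combination_identity (j : nat) (mu c t : R[i])
    (u1 u2 u3 u4 u5 u6 : ext) :
  mu = j%:R * (n%:R - k%:R - j%:R + 1) ->
  u1 + j%:R *: u2 - (mu *: u3 + (mu * (j%:R - 1)) *: u4)
    - (c *: u5 + (c * t) *: u6) =
  j.+1%:R^-1 *: (- ((j.+1%:R * t * c) *: u6)) + j%:R *: u2
  + (j%:R * (j%:R - 1) * (k%:R - n%:R + j%:R - 1)) *: u4
  + (u1 + (j%:R * (k%:R - n%:R + j%:R - 1)) *: u3 - c *: u5).
Proof.
move=> ->; apply/ffunP => K; rewrite !(extD, extN, extZ); field.
by rewrite nat1r pnatr_eq0.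
Qed.

Lemma twisted_commutator (j : nat) :
  lam_at (d_iter_lef j)
    - (j%:R * (n%:R - k%:R - j%:R + 1)) *: d_iter_lef (j - 1)
    - star_at (pull (invmx Jm) (star_coef_cut j *: d_iter_lef (n - k - j))) =
  j.+1%:R^-1 *: pull (invmx Jm)
    (- ((j.+1%:R * (n - k - j)%:R * star_coef_cut j) *:
      star_at (T (iter (n - k - j - 1) lef_at x))))
  + j%:R *: lam_at (T (iter (j - 1) lef_at x))
  + (j%:R * (j%:R - 1) * (k%:R - n%:R + j%:R - 1)) *: T (iter (j - 2) lef_at x)
  + \sum_(2 <= r < k.+2) f_coef R[i] n k j r *: iter (j + r - 1) lef_at (a r).
Proof.
have := main_part_lefschetz j ha a0; rewrite -Da => <-; rewrite /main_part.
rewrite -/(star_coef_cut j); set c := star_coef_cut j.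
have -> : lam_at (d_iter_lef j) =
    lam_at (iter j lef_at D) + j%:R *: lam_at (T (iter (j - 1) lef_at x)).
  by rewrite /d_iter_lef [LHS]linearD; congr (_ + _); exact: linearZ.
set mu := j%:R * (n%:R - k%:R - j%:R + 1).
have -> : mu *: d_iter_lef (j - 1) =
    mu *: iter (j - 1) lef_at D + (mu * (j%:R - 1)) *: T (iter (j - 2) lef_at x).
  rewrite /d_iter_lef scalerDr scalerA -subnDA /mu.
  by case: (j) => [|p]; [rewrite !mul0r | rewrite subSS subn0 -[p.+1%:R]natr1 addrK].
have -> : star_at (pull (invmx Jm) (c *: d_iter_lef (n - k - j))) =
    c *: pull (invmx Jm) (star_at (iter (n - k - j) lef_at D)) +
    (c * (n - k - j)%:R) *:
      pull (invmx Jm) (star_at (T (iter (n - k - j - 1) lef_at x))).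
  rewrite star_at_pull_inv /d_iter_lef; move: (iter _ lef_at D) (T _) => u v.
  have starZ b y : star_at (b *: y) = b *: star_at y by exact: linearZ.
  have -> : star_at (c *: (u + (n - k - j)%:R *: v)) =
      c *: star_at u + (c * (n - k - j)%:R) *: star_at v.
    rewrite starZ -scalerA -scalerDr; congr (_ *: _).
    by rewrite [LHS]linearD; congr (_ + _); exact: starZ.
  by rewrite [LHS]linearD; congr (_ + _); exact: linearZ.
have -> : pull (invmx Jm) (- ((j.+1%:R * (n - k - j)%:R * c) *:
      star_at (T (iter (n - k - j - 1) lef_at x)))) =
    - ((j.+1%:R * (n - k - j)%:R * c) *: pull (invmx Jm)
      (star_at (T (iter (n - k - j - 1) lef_at x)))).
  by rewrite [LHS]linearN; apply: congr1; exact: linearZ.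
exact: linear_combination_identity.
Qed.

End TwistedDerivation.

End HermitianVectorSpace.

(** * Partial derivatives of forms *)

Section PartialDerivatives.
Variables (R : realType) (m : nat).
Local Notation ext := (exterior R m).
Local Notation rV := 'rV[R]_m.
Implicit Types (i k : 'I_m) (x : rV).

(** Existence and value of the partial derivative in one predicate, so that the rules compose as
    those of [is_derive] do. *)
Definition is_partialC i (f : rV -> R[i]) x (d : R[i]) :=
  is_derive x 'e_i (fun y => complex.Re (f y)) (complex.Re d) /\
  is_derive x 'e_i (fun y => complex.Im (f y)) (complex.Im d).

Lemma is_partialC_val i f x d : is_partialC i f x d -> partialC i f x = d.
Proof.
by case: d => a b [/= [_ ea] [_ eb]]; rewrite /partialC ea eb.
Qed.

Lemma is_partialC_near i f f' x d : (\forall y \near x, f y = f' y) ->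
  is_partialC i f x d -> is_partialC i f' x d.
Proof.
move=> ff' [h1 h2]; split; [apply: near_eq_is_derive h1 | apply: near_eq_is_derive h2].
- by apply: filterS ff' => y ->.
- by apply: filterS ff' => y ->.
Qed.

Lemma is_partialC0 i x : is_partialC i (fun=> 0) x 0.
Proof. by split => /=; apply: is_derive_cst. Qed.

Lemma is_partialCD i f f' x d d' : is_partialC i f x d -> is_partialC i f' x d' ->
  is_partialC i (fun y => f y + f' y) x (d + d').
Proof.
move=> [h1 h2] [h1' h2']; split.
- have := is_deriveD h1 h1'; rewrite raddfD; congr (is_derive _ _ _ _).
  by apply/funext => y; rewrite raddfD.
- have := is_deriveD h2 h2'; rewrite raddfD; congr (is_derive _ _ _ _).
  by apply/funext => y; rewrite raddfD.
Qed.

Lemma ReM (z w : R[i]) : complex.Re (z * w) =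
  complex.Re z * complex.Re w - complex.Im z * complex.Im w.
Proof. by case: z; case: w. Qed.

Lemma ImM (z w : R[i]) : complex.Im (z * w) =
  complex.Re z * complex.Im w + complex.Im z * complex.Re w.
Proof. by case: z => a b; case: w => c e /=; rewrite [b * c]mulrC mulrC. Qed.

Lemma is_partialCZ i (c : R[i]) f x d : is_partialC i f x d ->
  is_partialC i (fun y => c * f y) x (c * d).
Proof.
move=> [h1 h2]; split.
- have := is_deriveB (is_deriveZ (complex.Re c) h1) (is_deriveZ (complex.Im c) h2).
  rewrite ReM; congr (is_derive _ _ _ _).
  by apply/funext => y; rewrite ReM.
- have := is_deriveD (is_deriveZ (complex.Re c) h2) (is_deriveZ (complex.Im c) h1).
  rewrite ImM; congr (is_derive _ _ _ _).
  by apply/funext => y; rewrite ImM.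
Qed.

Lemma is_partialCM i (u : rV -> R) f x (du : R) d :
  is_derive x 'e_i u du -> is_partialC i f x d ->
  is_partialC i (fun y => (u y)%:C%C * f y) x (du%:C%C * f x + (u x)%:C%C * d).
Proof.
move=> hu [h1 h2]; split.
- have := is_deriveM hu h1; rewrite raddfD /= !ReM /= !mul0r !subr0.
  rewrite addrC [_ *: du]mulrC; congr (is_derive _ _ _ _).
  by apply/funext => y; rewrite ReM /= mul0r subr0.
- have := is_deriveM hu h2; rewrite raddfD /= !ImM /= !mul0r !addr0.
  rewrite addrC [_ *: du]mulrC; congr (is_derive _ _ _ _).
  by apply/funext => y; rewrite ImM /= mul0r addr0.
Qed.

Definition is_partialE i (F : rV -> ext) x (d : ext) :=
  forall K : {set 'I_m}, is_partialC i (fun y => F y K) x (d K).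

Lemma is_partialE_val i F x d : is_partialE i F x d ->
  [ffun K : {set 'I_m} => partialC i (fun y => F y K) x] = d.
Proof. by move=> h; apply/ffunP => K; rewrite ffunE; apply: is_partialC_val. Qed.

Lemma is_partialE_near i F F' x d : (\forall y \near x, F y = F' y) ->
  is_partialE i F x d -> is_partialE i F' x d.
Proof.
move=> FF' h K; apply: is_partialC_near (h K).
by apply: filterS FF' => y ->.
Qed.

Lemma is_partialE_sum i x (T : Type) (r : seq T) (F : T -> rV -> ext) (d : T -> ext) :
  (forall t, is_partialE i (F t) x (d t)) ->
  is_partialE i (fun y => \sum_(t <- r) F t y) x (\sum_(t <- r) d t).
Proof.
move=> h K; elim: r => [|t r IH].
  rewrite big_nil ext0; have := is_partialC0 i x; congr is_partialC.
  by apply/funext => y; rewrite big_nil ext0.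
rewrite big_cons extD; have := is_partialCD (h t K) IH; congr is_partialC.
by apply/funext => y; rewrite big_cons extD.
Qed.

Lemma is_partialEZ i (c : R[i]) F x d : is_partialE i F x d ->
  is_partialE i (fun y => c *: F y) x (c *: d).
Proof.
move=> h K; rewrite extZ; have := is_partialCZ c (h K); congr is_partialC.
by apply/funext => y; rewrite extZ.
Qed.

Lemma is_partialEM i (u : rV -> R) F x (du : R) d :
  is_derive x 'e_i u du -> is_partialE i F x d ->
  is_partialE i (fun y => (u y)%:C%C *: F y) x
    (du%:C%C *: F x + (u x)%:C%C *: d).
Proof.
move=> hu h K; rewrite extD !extZ; have := is_partialCM hu (h K).
by congr is_partialC; apply/funext => y; rewrite extZ.
Qed.

Lemma is_partialE_crea i k F x d : is_partialE i F x d ->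
  is_partialE i (fun y => crea k (F y)) x (crea k d).
Proof.
move=> h K; rewrite ffunE; case: ifP => kK.
  have := is_partialCZ (sgn_ins R k K) (h (K :\ k)); congr is_partialC.
  by apply/funext => y; rewrite ffunE kK.
have := is_partialC0 i x; congr is_partialC.
by apply/funext => y; rewrite ffunE kK.
Qed.

End PartialDerivatives.

(** * Forms on an almost Hermitian manifold *)

Section LocalExpressions.
Variables (R : realType) (m : nat) (M : smoothManifold R m).
Implicit Types (w : diffForm M) (a : charts M) (p : M).

Definition local_expr w a : 'rV[R]_m -> exterior R m := fun x => w a (chart_inv a x).

(** The regularity carried from alpha to every L^j alpha. *)
Definition has_partials w := forall a p i, dom a p ->
  exists d, is_partialE i (local_expr w a) (chart a p) d.

Lemma near_chart a p (P : 'rV[R]_m -> Prop) : dom a p ->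
  (forall q, dom a q -> P (chart a q)) -> \forall y \near chart a p, P y.
Proof.
move=> ap hP; have h : nbhs (chart a p) (chart a @` dom a)%classic.
  by apply: open_nbhs_nbhs; split; [exact: chart_image_open | exists p].
by apply: filterS h => y [q aq <-]; exact: hP.
Qed.

Lemma smooth_fun_derivable a p (f : M -> R) (i : 'I_m) : dom a p ->
  smooth_fun a f -> derivable (fun x => f (chart_inv a x)) (chart a p) 'e_i.
Proof.
move=> ap /(_ 1%N) [_ /(_ i)[h _]]; apply: h.
by exists p.
Qed.

Lemma is_form_has_partials w : is_form w -> has_partials w.
Proof.
move=> [sw _] a p i ap.
exists [ffun K : {set 'I_m} =>
  partialC i (fun y => local_expr w a y K) (chart a p)] => K.
rewrite ffunE; have [sRe sIm] := sw a K; split => /=; apply/derivableP.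
  exact: smooth_fun_derivable ap sRe.
exact: smooth_fun_derivable ap sIm.
Qed.

Lemma ext_dE w a p (d : 'I_m -> exterior R m) :
  (forall i, is_partialE i (local_expr w a) (chart a p) (d i)) ->
  ext_d w a p = \sum_i crea i (d i).
Proof.
move=> h; apply: eq_bigr => i _; rewrite wedge_dx; congr crea.
exact: is_partialE_val.
Qed.

(** Makes it possible to apply d to forms built with star and Lambda without differentiating these
    operators. The relation is asked on the whole chart domain, whose open image makes it hold near
    the point. *)
Lemma ext_d_scale (c : R[i]) w1 w2 a p : has_partials w2 -> dom a p ->
  (forall q, dom a q -> w1 a q = c *: w2 a q) ->
  ext_d w1 a p = c *: ext_d w2 a p.
Proof.
move=> hw2 ap e; have [d hd] := choice (fun i => hw2 a p i ap).
rewrite (ext_dE hd) (@ext_dE w1 a p (fun i => c *: d i)).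
  by rewrite scaler_sumr; apply: eq_bigr => i _; rewrite linearZ.
move=> i; apply: is_partialE_near (is_partialEZ c (hd i)).
by apply: near_chart ap _ => q aq; rewrite /local_expr chartK // e.
Qed.

End LocalExpressions.

(** * The Leibniz rule for L on the manifold *)

Section AlmostHermitianForms.
Variables (R : realType) (n : nat) (M : smoothManifold R n.*2).
Variable H : almostHermitian M.
Local Notation m := n.*2.
Implicit Types (w : diffForm M) (a : charts M) (p : M).
Local Notation J := (cplx H).
Local Notation g := (metric H).

Lemma hermitian_pair_at a p : dom a p -> hermitian_pair (J a p) (g a p).
Proof.
move=> ap; split; [exact: cplx_sqr|exact: Defs.metric_sym| |exact: metric_cplx].
by move=> v; exact: metric_pos.
Qed.

Lemma starE w a p : star H w a p = star_at (J a p) (g a p) (w a p).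
Proof. by []. Qed.

Lemma lefE w a p : lef H w a p = lef_at (J a p) (g a p) (w a p).
Proof. by []. Qed.

Lemma iter_lefE j w a p :
  iter j (lef H) w a p = iter j (lef_at (J a p) (g a p)) (w a p).
Proof. by elim: j => //= j IH; rewrite lefE IH. Qed.

Lemma lamE w a p : dom a p -> lam H w a p = lam_at (J a p) (g a p) (w a p).
Proof.
by move=> ap; rewrite -(hodge_star_inv_lef_star (hermitian_pair_at ap)).
Qed.

Definition domega a p (k : 'I_m) : 'M[R]_m := \matrix_(i, j)
  'D_('e_k) (fun y => (J a (chart_inv a y) *m g a (chart_inv a y)) i j) (chart a p).

Lemma is_derive_omega a p k i j : dom a p ->
  is_derive (chart a p) 'e_k
    (fun y => (J a (chart_inv a y) *m g a (chart_inv a y)) i j) (domega a p k i j).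
Proof.
move=> ap; rewrite mxE; apply/derivableP.
have -> : (fun y => (J a (chart_inv a y) *m g a (chart_inv a y)) i j) =
  \sum_(l < m) ((fun y => J a (chart_inv a y) i l) * (fun y => g a (chart_inv a y) l j)).
  by apply/funext => y; rewrite mxE fct_sumE.
apply: derivable_sum => l; apply: derivableM.
  exact: smooth_fun_derivable ap (cplx_smooth H a i l).
exact: smooth_fun_derivable ap (metric_smooth H a l j).
Qed.

(** The wedge with d omega as the sum of the dx_k /\ (partial_k omega); the factor 1/2 is that of
    [lef_atE]. *)
Definition wedge_domega a p (x : exterior R m) : exterior R m :=
  \sum_k crea k (2%:R^-1 *: quad (@crea R m) (domega a p k) x).

Lemma wedge_domega_is_linear a p : linear (wedge_domega a p).
Proof.
move=> c x y; rewrite /wedge_domega scaler_sumr -big_split; apply: eq_bigr => k _ /=.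
by rewrite linearP scalerDr [crea k _]linearD scalerA mulrC -scalerA linearZ.
Qed.
HB.instance Definition _ a p := GRing.isLinear.Build R[i] (exterior R m)
  (exterior R m) *:%R (wedge_domega a p) (wedge_domega_is_linear a p).

Lemma lef_wedge_domega a p x : dom a p ->
  lef_at (J a p) (g a p) (wedge_domega a p x) = wedge_domega a p (lef_at (J a p) (g a p) x).
Proof.
move=> ap.
have crea_lef := lef_at_crea (hermitian_pair_at ap).
have mix_lef := lef_at_mixM_crea (hermitian_pair_at ap).
rewrite /wedge_domega (linear_sum (lef_at (J a p) (g a p))); apply: eq_bigr => k _ /=.
rewrite crea_lef; congr crea; rewrite [LHS]linearZ; congr (_ *: _) => /=.
rewrite /quad (linear_sum (lef_at (J a p) (g a p))); apply: eq_bigr => j _ /=.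
by rewrite mix_lef crea_lef.
Qed.

Lemma lef_partials w a p : has_partials w -> dom a p ->
  exists2 d : 'I_m -> exterior R m,
    forall k, is_partialE k (local_expr w a) (chart a p) (d k) &
    forall k, is_partialE k (local_expr (lef H w) a) (chart a p)
      (2%:R^-1 *: quad (@crea R m) (domega a p k) (w a p)
       + lef_at (J a p) (g a p) (d k)).
Proof.
move=> hw ap; have [d hd] := choice (fun i => hw a p i ap).
exists d => // k.
have lef_quad q : dom a q -> lef H w a q =
    2%:R^-1 *: quad (@crea R m) (J a q *m g a q) (w a q).
  by move=> aq; rewrite lefE (lef_atE (hermitian_pair_at aq)).
rewrite (lef_atE (hermitian_pair_at ap)) -scalerDr.
apply: (@is_partialE_near _ _ _ (fun y => 2%:R^-1 *: \sum_j \sum_i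
   ((J a (chart_inv a y) *m g a (chart_inv a y)) i j)%:C%C *:
      crea i (crea j (local_expr w a y)))).
  by apply: near_chart ap _ => q aq; rewrite /local_expr !chartK // lef_quad.
apply: is_partialEZ; rewrite /quad -big_split /=.
apply: is_partialE_sum => j; rewrite /mixM -big_split /=.
apply: is_partialE_sum => i.
have := is_partialEM (is_derive_omega k i j ap)
  (is_partialE_crea i (is_partialE_crea j (hd k))).
by rewrite /local_expr chartK.
Qed.

Lemma lef_has_partials w : has_partials w -> has_partials (lef H w).
Proof.
by move=> hw a p i ap; have [d _ h] := lef_partials hw ap; eexists; exact: h.
Qed.

Lemma ext_d_lef w a p : has_partials w -> dom a p ->
  ext_d (lef H w) a p = lef_at (J a p) (g a p) (ext_d w a p) + wedge_domega a p (w a p).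
Proof.
move=> hw ap; have [d hd hl] := lef_partials hw ap.
rewrite (ext_dE hd) (ext_dE hl) (linear_sum (lef_at (J a p) (g a p))) addrC.
rewrite -big_split; apply: eq_bigr => k _ /=; rewrite [LHS]linearD; congr (_ + _).
by rewrite (lef_at_crea (hermitian_pair_at ap)).
Qed.

Lemma iter_lef_has_partials j w : has_partials w -> has_partials (iter j (lef H) w).
Proof. by move=> hw; elim: j => //= j; exact: lef_has_partials. Qed.

Lemma ext_d_iter_lef j w a p : has_partials w -> dom a p ->
  ext_d (iter j (lef H) w) a p =
  d_iter_lef (J a p) (g a p) (wedge_domega a p) (w a p) (ext_d w a p) j.
Proof.
move=> hw ap; elim: j => [|j IH].
  by rewrite /d_iter_lef scale0r addr0.
rewrite iterS (ext_d_lef (iter_lef_has_partials j hw) ap) IH iter_lefE.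
have e := d_iter_lefS (w a p) (ext_d w a p) (fun y => lef_wedge_domega y ap) j.
have sub_addE (u v t : exterior R m) : u - v = t -> v + t = u.
  by move=> <-; rewrite addrC subrK.
exact: sub_addE e.
Qed.

End AlmostHermitianForms.

(** * Differentials and commutators on the forms L^j alpha *)

Section PrimitiveForms.
Variables (R : realType) (n : nat) (M : smoothManifold R n.*2).
Variable H : almostHermitian M.
Local Notation m := n.*2.
Implicit Types (w : diffForm M) (a : charts M) (p : M).
Local Notation J := (cplx H).
Local Notation g := (metric H).

Lemma formD w1 w2 a p : (w1 + w2) a p = w1 a p + w2 a p. Proof. by []. Qed.
Lemma formN w a p : (- w) a p = - w a p. Proof. by []. Qed.
Lemma formZ (c : R[i]) w a p : (c *: w) a p = c *: w a p. Proof. by []. Qed.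
Lemma form_sum (T : Type) (r : seq T) (P : pred T) (F : T -> diffForm M) a p :
  (\sum_(t <- r | P t) F t) a p = \sum_(t <- r | P t) F t a p.
Proof. by elim/big_rec2: _ => // t u v _ <-. Qed.

Lemma bbIE w a p : bbI H w a p = pull (J a p) (w a p). Proof. by []. Qed.

Lemma bbI_invE w a p : bbI_inv H w a p = pull (invmx (J a p)) (w a p).
Proof. by []. Qed.

Lemma dstarE w a p :
  dstar H w a p = - star_at (J a p) (g a p) (ext_d (star H w) a p).
Proof. by []. Qed.

Local Opaque ext_d star lef lam bbI bbI_inv dstar.

Variables (k : nat) (alpha : diffForm M).
Hypothesis alpha_primitive : is_primitive H k alpha.

Let alpha_hom a p : dom a p -> homogeneous k%:Z (alpha a p).
Proof. by case: alpha_primitive => -[_ h] _; exact: h. Qed.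

Let alpha_lam a p : dom a p -> lam_at (J a p) (g a p) (alpha a p) = 0.
Proof. by move=> ap; rewrite -(lamE _ _ ap); case: alpha_primitive => _ ->. Qed.

Let alpha_partials : has_partials alpha.
Proof. by apply: is_form_has_partials; case: alpha_primitive => -[]. Qed.

Let iter_lef_partials j : has_partials (iter j (lef H) alpha).
Proof. exact: iter_lef_has_partials. Qed.

Local Notation dL a p := (d_iter_lef (J a p) (g a p) (wedge_domega H a p) (alpha a p)
  (ext_d alpha a p)).

Let dLE j a p : dom a p -> ext_d (iter j (lef H) alpha) a p = dL a p j.
Proof. exact: ext_d_iter_lef. Qed.

(** Here and in the next three lemmas the differentiated form is a constant multiple of some L^i
    alpha, so [ext_d_scale] applies. *)
Lemma ext_d_lam_iter_lef j a p : dom a p ->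
  ext_d (lam H (iter j (lef H) alpha)) a p =
  (j%:R * (n%:R - k%:R - j%:R + 1)) *: dL a p (j - 1).
Proof.
move=> ap; rewrite -dLE //; apply: ext_d_scale => // q aq.
rewrite (lamE _ _ aq) !iter_lefE.
exact: (lam_at_iter_lef (hermitian_pair_at H aq) _ (alpha_hom aq) (alpha_lam aq)).
Qed.

Lemma ext_d_bbI_star_iter_lef j a p : dom a p ->
  ext_d (bbI H (star H (iter j (lef H) alpha))) a p =
  star_coef_cut R n k j *: dL a p (n - k - j).
Proof.
move=> ap; rewrite -dLE //; apply: ext_d_scale => // q aq.
rewrite bbIE starE !iter_lefE.
exact: (pull_star_iter_lef (hermitian_pair_at H aq) (alpha_hom aq) (alpha_lam aq)).
Qed.

Lemma ext_d_star_bbI_iter_lef j a p : dom a p ->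
  ext_d (star H (bbI H (iter j (lef H) alpha))) a p =
  star_coef_cut R n k j *: dL a p (n - k - j).
Proof.
move=> ap; rewrite -dLE //; apply: ext_d_scale => // q aq.
rewrite starE bbIE !iter_lefE.
exact: (star_pull_iter_lef (hermitian_pair_at H aq) (alpha_hom aq) (alpha_lam aq)).
Qed.

Lemma ext_d_star_lam_bbI_iter_lef j a p : dom a p ->
  ext_d (star H (lam H (bbI H (iter j.+1 (lef H) alpha)))) a p =
  (j.+1%:R * (n%:R - k%:R - j%:R) * star_coef_cut R n k j) *: dL a p (n - k - j).
Proof.
move=> ap; rewrite -dLE //; apply: ext_d_scale => // q aq.
rewrite starE (lamE _ _ aq) bbIE !iter_lefE.
exact: (star_lam_pull_iter_lef (hermitian_pair_at H aq) (alpha_hom aq) (alpha_lam aq)).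
Qed.

Lemma comm_op_d_lef j a p : dom a p ->
  comm_op (@ext_d R m M) (lef H) (iter j (lef H) alpha) a p =
  wedge_domega H a p (iter j (lef_at (J a p) (g a p)) (alpha a p)).
Proof.
move=> ap; rewrite /comm_op formD formN lefE (dLE j ap) -iterS (dLE j.+1 ap).
exact: (d_iter_lefS (alpha a p) (ext_d alpha a p) (fun y => lef_wedge_domega H y ap) j).
Qed.

Lemma comm_op_dstar_lam_bbI j a p : dom a p ->
  comm_op (dstar H) (lam H) (bbI H (iter j.+1 (lef H) alpha)) a p =
  - ((j.+1%:R * (n - k - j)%:R * star_coef_cut R n k j) *:
      star_at (J a p) (g a p)
        (wedge_domega H a p (iter (n - k - j - 1) (lef_at (J a p) (g a p)) (alpha a p)))).
Proof.
move=> ap; rewrite /comm_op formD formN (lamE _ _ ap) !dstarE.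
(* With d* = - star d star, the two inner differentials are those of star Lambda I L^(j+1) alpha and
   star I L^(j+1) alpha. *)
apply: (etrans (congr2
  (fun u v => - star_at (J a p) (g a p) u
    - lam_at (J a p) (g a p) (- star_at (J a p) (g a p) v))
  (ext_d_star_lam_bbI_iter_lef j ap) (ext_d_star_bbI_iter_lef j.+1 ap))).
apply: (commutator_star (hermitian_pair_at H ap)) => y; exact: lef_wedge_domega.
Qed.

End PrimitiveForms.

Local Opaque ext_d star lef lam bbI bbI_inv dstar.

Theorem theorem3p1 (R : realType) (n : nat) (M : smoothManifold R n.*2)
    (H : almostHermitian M) (k : nat) (alpha : diffForm M)
    (alpha_ : nat -> diffForm M) :
  is_primitive H k alpha ->
  lefschetz_decomposition H k.+1 (ext_d alpha) alpha_ ->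
  forall j : nat,
    comm_op (lam H) (@ext_d R n.*2 M) (iter j (lef H) alpha)
    - star H (bbI_inv H (ext_d (bbI H (star H (iter j (lef H) alpha)))))
    =_form
    j.+1%:R^-1 *:
      bbI_inv H (comm_op (dstar H) (lam H)
                   (bbI H (iter j.+1 (lef H) alpha)))
    + j%:R *:
      lam H (comm_op (@ext_d R n.*2 M) (lef H) (iter (j - 1) (lef H) alpha))
    + (j%:R * (j%:R - 1) * (k%:R - n%:R + j%:R - 1)) *:
      comm_op (@ext_d R n.*2 M) (lef H) (iter (j - 2) (lef H) alpha)
    + \sum_(2 <= r < k.+2)
        f_coef R[i] n k j r *: iter (j + r - 1) (lef H) (alpha_ r).
Proof.
move=> alpha_primitive [alpha_r_primitive _ d_alpha] j a p ap.
rewrite !formD !formN !formZ form_sum starE !bbI_invE.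
rewrite [comm_op (lam H) _ _]/comm_op formD formN !(lamE _ _ ap).
rewrite (ext_d_lam_iter_lef alpha_primitive _ ap).
rewrite (ext_d_bbI_star_iter_lef alpha_primitive _ ap).
rewrite (comm_op_dstar_lam_bbI alpha_primitive _ ap).
rewrite !(comm_op_d_lef alpha_primitive _ ap).
rewrite ext_d_iter_lef //; last first.
  by apply: is_form_has_partials; case: alpha_primitive => -[].
under [in RHS]eq_bigr => r _ do rewrite formZ iter_lefE.
(* All differentials are now explicit, and the goal is an identity in one exterior algebra. What
   remains is the degree and primitivity of the alpha_r and the decomposition of d alpha at the
   point. *)
apply: (twisted_commutator (hermitian_pair_at H ap)).
- by move=> r; have [[_ h] _] := alpha_r_primitive r; exact: h.
- by move=> r; have [_ h] := alpha_r_primitive r; rewrite -(lamE _ _ ap) h.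
- by rewrite d_alpha // form_sum; apply: eq_bigr => r _; rewrite iter_lefE.
Qed.
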